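(* Let $\{Z_t\}_{t\ge 0}$ be a time-inhomogeneous birth-and-death process with death rate $b_{-1}$ and birth rates $b_1,\dots,b_n$, and let $M(t)$, $\Gamma(t)$ and $\zeta_t$ be as defined in the context. Assume: (i) $\liminf_{t\to\infty}b_{-1}(t)>0$; (ii) $\liminf_{t\to\infty}\left[b_1(t)+\dots+b_n(t)\right]>0$; (iii) $\sup_{t\ge 0}\left[b_{-1}(t)+b_1(t)+\dots+b_n(t)\right]<\infty$; (iv) $\Gamma(t)\to\infty$ as $t\to\infty$; (v) $M(t)\Gamma(t)\to\infty$ as $t\to\infty$. Then $\zeta_t/E(\zeta_t)$ converges in moments, as $t\to\infty$, to an exponential random variable with parameter $1$; that is, for every integer $r\ge 1$, $E\left((\zeta_t/E(\zeta_t))^r\right)\to r!$ as $t\to\infty$.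
   Context: Fix an integer $n\ge 1$ and measurable functions $b_{-1},b_1,\dots,b_n:[0,\infty)\to[0,\infty)$ (the death rate and birth rates). The time-inhomogeneous birth-and-death process $\{Z_t\}_{t\ge 0}$ is the time-inhomogeneous Markov jump process on $\{0,1,2,\dots\}$ with $Z_0=1$ and infinitesimal transition probabilities $P(Z_{t+\Delta}-Z_t=k\mid Z_t)=Z_t\Delta b_k(t)+o(\Delta)$ for $k=-1,1,\dots,n$ and $P(Z_{t+\Delta}-Z_t=0\mid Z_t)=1-Z_t\Delta\,(b_{-1}(t)+b_1(t)+\dots+b_n(t))+o(\Delta)$; i.e. at time $t$ in state $i$ it jumps to $i+k$ with intensity $i\,b_k(t)$, $k\in\{-1,1,\dots,n\}$. Purely as notation ($X_t$ is not an actual random variable), $E(X_t^r)=\sum_{k=-1,1,\dots,n}k^r b_k(t)$ for $r\ge 1$. Let $M(t)=E(Z_t)$ and $$\Gamma(t)=\int_0^t\frac{E(X_s^2)}{2M(s)}\,ds.$$ $\zeta_t$ denotes $Z_t$ conditioned on non-extinction, i.e. a random variable whose law is the conditional law of $Z_t$ given $\{Z_t\neq 0\}$. *)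

(* Defs.v *)
From HB Require Import structures.
From mathcomp Require Import all_boot all_order all_algebra.
From mathcomp Require Import all_classical all_reals all_analysis.
Set Implicit Arguments.
Unset Strict Implicit.
Unset Printing Implicit Defensive.
Import Order.TTheory GRing.Theory Num.Theory numFieldNormedType.Exports.
Local Open Scope classical_set_scope.
Local Open Scope ring_scope.

Definition cprob (d : measure_display) (T : measurableType d) (R : realType)
    (P : probability T R) (A B : set T) : R :=
  fine (P (A `&` B)) / fine (P B).

Definition jumps (n : nat) : seq int := (-1) :: [seq k%:Z | k <- iota 1 n].

Definition birth_rate (R : realType) (n : nat) (b : int -> R -> R) (t : R) : R :=
  \sum_(1 <= k < n.+1) b k%:Z t.

Definition total_rate (R : realType) (n : nat) (b : int -> R -> R) (t : R) : R :=
  b (-1) t + birth_rate n b t.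

(* The sum abbreviated E(X_t^r); X_t is not a random variable. *)
Definition jump_moment (R : realType) (n : nat) (b : int -> R -> R) (r : nat)
    (t : R) : R :=
  \sum_(k <- jumps n) k%:~R ^+ r * b k t.

Section Process.
Variables (R : realType) (d : measure_display) (T : measurableType d).
Variables (P : probability T R).
Implicit Types (Z : R -> {RV P >-> nat}) (b : int -> R -> R).

(* Paths are right-continuous step functions with finitely many jumps in each
   bounded time interval. *)
Definition jump_path (z : R -> nat) : Prop :=
  forall t, 0 <= t ->
    (\forall u \near t^'+, z u = z t) /\
    (0 < t -> exists i, \forall u \near t^'-, z u = i).

(* Since the state space is countable, it is enough to condition on the states
   visited at finitely many past times, listed in h as pairs (time, state). *)
Definition markov_property Z : Prop :=
  forall (h : seq (R * nat)) (s t : R) (i j : nat),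
    (forall p, p \in h -> 0 <= p.1 <= s) -> 0 <= s -> s <= t ->
    let past := [set w | forall p, p \in h -> Z p.1 w = p.2] in
    (0 < P ([set w | Z s w = i] `&` past))%E ->
    cprob P [set w | Z t w = j] ([set w | Z s w = i] `&` past) =
    cprob P [set w | Z t w = j] [set w | Z s w = i].

(* P(Z_{t+D} - Z_t = k | Z_t = i) = i * int_t^{t+D} q(u) du + o(D) as D -> 0+,
   the o(D) being uniform for t in bounded intervals.  If q is continuous the
   leading term is i * D * q(t) + o(D); if q is only measurable (and bounded),
   the pointwise form can be required at almost every t only.  Without the
   uniformity in t, jumps at deterministic times would not be excluded. *)
Definition jump_intensity Z (k : int) (q : R -> R) : Prop :=
  forall (i : nat) (a e : R), 0 < e ->
    \forall D \near 0^'+, forall t, 0 <= t <= a ->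
      (0 < P [set w | Z t w = i])%E ->
      `| cprob P [set w | (Z (t + D) w)%:Z - (Z t w)%:Z = k] [set w | Z t w = i]
         - i%:R * \int[lebesgue_measure]_(u in `[t, t + D]) q u | <= e * D.

Definition no_jump_intensity Z (q : R -> R) : Prop :=
  forall (i : nat) (a e : R), 0 < e ->
    \forall D \near 0^'+, forall t, 0 <= t <= a ->
      (0 < P [set w | Z t w = i])%E ->
      `| cprob P [set w | (Z (t + D) w)%:Z - (Z t w)%:Z = 0] [set w | Z t w = i]
         - (1 - i%:R * \int[lebesgue_measure]_(u in `[t, t + D]) q u) | <= e * D.

Record birth_death_process (n : nat) b Z : Prop := BirthDeathProcess {
  bd_start : {ae P, forall w, Z 0 w = 1%N};
  bd_paths : {ae P, forall w, jump_path (fun t => Z t w)};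
  bd_markov : markov_property Z;
  bd_jump : forall k, k \in jumps n -> jump_intensity Z k (b k);
  bd_no_jump : no_jump_intensity Z (total_rate n b) }.

Definition mean (X : {RV P >-> nat}) : R := fine 'E_P[fun w => (X w)%:R].

Definition Gamma (n : nat) b Z (t : R) : R :=
  \int[lebesgue_measure]_(s in `[0, t]) (jump_moment n b 2 s / (2 * mean (Z s))).

End Process.

(* The law of zeta is the conditional law of X given X <> 0. *)
Definition conditioned_on_nonzero (R : realType)
    (d : measure_display) (T : measurableType d) (P : probability T R)
    (d' : measure_display) (T' : measurableType d') (Q : probability T' R)
    (X : {RV P >-> nat}) (zeta : {RV Q >-> nat}) : Prop :=
  forall A : set nat,
    distribution Q zeta A =
    (cprob P [set w | A (X w)] [set w | X w <> 0%N])%:E.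

(* Main.v *)
Require Import Defs.
From HB Require Import structures.
From mathcomp Require Import all_boot all_order all_algebra.
From mathcomp Require Import all_classical all_reals all_analysis.
From mathcomp Require Import measurable_realfun zify ring lra.
Set Implicit Arguments.
Unset Strict Implicit.
Unset Printing Implicit Defensive.
Import Order.TTheory GRing.Theory Num.Theory numFieldNormedType.Exports.
Local Open Scope classical_set_scope.
Local Open Scope ring_scope.

(** Write [m_r = E(X^r)], [nu = 1/M] and let [p] be the survival probability
at time [a].  Everything rests on one inequality: if [f t i >= 0] satisfies
[df/dt + generator f <= 0], then [E f(a, Z_a) <= f(0, 1)].  It is proved on the
grid [a/(N+1)] for the process killed outside a finite set of states, where the
errors [o(D)] of the intensities are uniform, and the killing is then removed
because almost every path is bounded on [[0, a]].

Taking [f = s(t)^i] or [f = 1 - s(t)^i], with [s = 1 - nu/w] and [w] an explicit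
integral that is a sub- or supersolution of the Riccati equation of the backward
generating function, bounds [1/p] between two expressions equal to
[Gamma + o(Gamma)]; so [p Gamma -> 1].  Taking [f] to be a polynomial in
[i nu(t)] with coefficients given by iterated integrals, plus a small multiple of
a higher power, yields [E(Z_a^r) nu(a)^r] exactly, and the leading coefficient
is [r! Gamma^(r-1)].  Finally
[E((zeta/E zeta)^r) = E(Z^r) nu^r p^(r-1) -> r!]. *)

(** * Primitives of bounded measurable functions *)

Section Primitives.
Context {R : realType}.
Implicit Types (a s t u : R) (f g phi psi : R -> R).

(** The rates are only measurable and the process is known only through short-time transition
    probabilities, so neither a differential equation for its law nor integrability of [Z_a] is
    available at the outset. Discarding paths removes nonnegative terms, so a one-sided inequality
    for nonnegative test functions survives truncation and killing where an identity would not;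
    equalities are recovered by testing with both signs. The intensities are proportional to the
    state, so all powers [s^i] are handled by one scalar inequality for [s], and in terms of [w]
    this becomes a comparison of integrals; the generating function itself is never solved for. Two
    asymptotic facts drive the limit: births bounded below give [nu <= (2/c) Gamma'] eventually, and
    [M Gamma -> +oo] says [nu = o(Gamma)]. Together they make the error in [1/p] and every
    contribution of third and higher jump moments negligible, so that only the second moment, hence
    [Gamma], remains. *)

Definition itg f s t : R := \int[lebesgue_measure]_(u in `[s, t]) f u.

Definition bmf a f : Prop :=
  measurable_fun (`[0, a] : set R) f /\
  exists C : R, forall x : R, 0 <= x <= a -> `|f x| <= C.

Lemma bmf_bound a f : bmf a f ->
  exists2 C : R, 0 <= C & forall x : R, 0 <= x <= a -> `|f x| <= C.
Proof.
move=> [_ [C hC]]; exists `|C|; first by [].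
by move=> x /hC /le_trans; apply; rewrite ler_norm.
Qed.

Lemma bmf_cst a c : bmf a (fun=> c).
Proof. by split; [exact: measurable_cst | exists `|c|]. Qed.

Lemma bmfD a f g : bmf a f -> bmf a g -> bmf a (fun x => f x + g x).
Proof.
move=> [mf [C hC]] [mg [D hD]]; split; first exact: measurable_funD.
exists (C + D) => x hx; apply: le_trans (ler_normD _ _) _.
by rewrite lerD ?hC ?hD.
Qed.

Lemma bmfM a f g : bmf a f -> bmf a g -> bmf a (fun x => f x * g x).
Proof.
move=> [mf [C hC]] [mg [D hD]]; split; first exact: measurable_funM.
by exists (C * D) => x hx; rewrite normrM ler_pM ?hC ?hD.
Qed.

Lemma bmfZ a c f : bmf a f -> bmf a (fun x => c * f x).
Proof. by apply: bmfM; exact: bmf_cst. Qed.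

Lemma bmfN a f : bmf a f -> bmf a (fun x => - f x).
Proof.
move=> hf; have := bmfZ (-1) hf.
by under eq_fun do rewrite mulN1r.
Qed.

Lemma bmfB a f g : bmf a f -> bmf a g -> bmf a (fun x => f x - g x).
Proof. by move=> hf hg; apply: bmfD => //; exact: bmfN. Qed.

Lemma bmfX a f k : bmf a f -> bmf a (fun x => f x ^+ k).
Proof.
move=> hf; elim: k => [|k IH].
  by under eq_fun do rewrite expr0; exact: bmf_cst.
by under eq_fun do rewrite exprS; exact: bmfM.
Qed.

Lemma bmf_sum (I : eqType) (r : seq I) (F : I -> R -> R) a :
  (forall i, i \in r -> bmf a (F i)) ->
  bmf a (fun x => \sum_(i <- r) F i x).
Proof.
elim: r => [|i r IH] h.
  by under eq_fun do rewrite big_nil; exact: bmf_cst.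
under eq_fun do rewrite big_cons.
apply: bmfD; first by apply: h; rewrite mem_head.
by apply: IH => j jr; apply: h; rewrite inE jr orbT.
Qed.

Lemma bmf_itg a f s t : bmf a f -> 0 <= s -> t <= a ->
  lebesgue_measure.-integrable (`[s, t] : set R) (EFin \o f).
Proof.
move=> [mf [C hC]] s0 ta; have sub : `[s, t] `<=` `[0, a].
  move=> x /=; rewrite !in_itv /= => /andP[sx xt].
  by rewrite (le_trans s0 sx) (le_trans xt ta).
apply: measurable_bounded_integrable => //.
- by rewrite /= lebesgue_measure_itv /=; case: ifP => // _; rewrite -EFinB ltry.
- by apply: measurable_funS mf.
- exists C; split; first by rewrite num_real.
  move=> x Cx y /sub; rewrite /= in_itv /= => hy.
  exact: le_trans (hC _ hy) (ltW Cx).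
Qed.

Section Integral.
Variable a : R.

Lemma itgD f g s t : bmf a f -> bmf a g -> 0 <= s -> t <= a ->
  itg (fun u => f u + g u) s t = itg f s t + itg g s t.
Proof. by move=> hf hg s0 ta; apply: RintegralD => //; exact: bmf_itg ta. Qed.

Lemma itgB f g s t : bmf a f -> bmf a g -> 0 <= s -> t <= a ->
  itg (fun u => f u - g u) s t = itg f s t - itg g s t.
Proof. by move=> hf hg s0 ta; apply: RintegralB => //; exact: bmf_itg ta. Qed.

Lemma itgZ c f s t : bmf a f -> 0 <= s -> t <= a ->
  itg (fun u => c * f u) s t = c * itg f s t.
Proof. by move=> hf s0 ta; apply: RintegralZl => //; exact: bmf_itg ta. Qed.

Lemma itgN f s t : bmf a f -> 0 <= s -> t <= a ->
  itg (fun u => - f u) s t = - itg f s t.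
Proof.
move=> hf s0 ta; rewrite -mulN1r -itgZ //.
by congr (itg _ _ _); apply/funext => u; rewrite mulN1r.
Qed.

Lemma eq_itg f g s t : (forall u, s <= u <= t -> f u = g u) ->
  itg f s t = itg g s t.
Proof.
move=> fg; apply: eq_Rintegral => x; rewrite inE /= in_itv /=; exact: fg.
Qed.

Lemma itg_cst c s t : s <= t -> itg (fun=> c) s t = c * (t - s).
Proof.
move=> st; rewrite /itg Rintegral_cst //.
congr (_ * _); rewrite /= lebesgue_measure_itv /= lte_fin.
move: st; rewrite le_eqVlt => /predU1P[->|->]; first by rewrite ltxx subrr.
by rewrite -EFinB.
Qed.

Lemma itgxx f s : itg f s s = 0.
Proof. by rewrite /itg set_itv1 Rintegral_set1. Qed.

Lemma itg_sum (I : eqType) (r : seq I) (F : I -> R -> R) s t :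
  (forall i, i \in r -> bmf a (F i)) -> 0 <= s -> s <= t -> t <= a ->
  itg (fun u => \sum_(i <- r) F i u) s t = \sum_(i <- r) itg (F i) s t.
Proof.
move=> h s0 st ta; elim: r h => [|i r IH] h.
  transitivity (itg (fun=> 0) s t); first by apply: eq_itg => u _; rewrite big_nil.
  by rewrite itg_cst // mul0r big_nil.
rewrite big_cons -IH; last by move=> j jr; apply: h; rewrite inE jr orbT.
rewrite -itgD //.
- by apply: eq_itg => u _; rewrite big_cons.
- by apply: h; rewrite mem_head.
- by apply: bmf_sum => j jr; apply: h; rewrite inE jr orbT.
Qed.

Lemma le_itg f g s t : bmf a f -> bmf a g -> 0 <= s -> t <= a ->
  (forall u, s <= u <= t -> f u <= g u) -> itg f s t <= itg g s t.
Proof.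
move=> hf hg s0 ta fg; apply: le_Rintegral => //.
- exact: bmf_itg ta.
- exact: bmf_itg ta.
Qed.

Lemma itg_ge0 f s t : (forall u, s <= u <= t -> 0 <= f u) -> 0 <= itg f s t.
Proof. by move=> f0; apply: Rintegral_ge0 => x; rewrite /= in_itv /=; exact: f0. Qed.

Lemma itg_chasles f s t u : bmf a f -> 0 <= s -> s <= t -> t <= u -> u <= a ->
  itg f s u = itg f s t + itg f t u.
Proof.
move=> hf s0 st tu ua.
have h := @Rintegral_itvB R f (BLeft s) (BRight u) t.
have i := bmf_itg hf s0 ua.
move: h => /(_ i); rewrite !bnd_simp => /(_ st tu).
rewrite -/(itg f s u) -/(itg f s t) Rintegral_itv_obnd_cbnd -/(itg f t u).
  by move=> <-; ring.
apply: integrableS i => //.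
by apply: subset_itvr; rewrite bnd_simp.
Qed.

Lemma le_norm_itg f s t C : bmf a f -> 0 <= s -> s <= t -> t <= a ->
  (forall u, s <= u <= t -> `|f u| <= C) -> `|itg f s t| <= C * (t - s).
Proof.
move=> hf s0 st ta h; rewrite -itg_cst // ler_norml -itgN //; last exact: bmf_cst.
apply/andP; split; (apply: le_itg => //; [exact: bmf_cst || exact/bmfN/bmf_cst..|]).
  by move=> u /h; rewrite ler_norml => /andP[].
by move=> u /h; rewrite ler_norml => /andP[].
Qed.

End Integral.

(* Halving the interval m times divides the bound by 2^m.  This replaces almost
   everywhere differentiation: the rates are only measurable. *)
Lemma quadratic_increments_cst (chi : R -> R) a K :
  (forall s t, 0 <= s -> s <= t -> t <= a -> `|chi t - chi s| <= K * (t - s) ^+ 2) ->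
  forall s t, 0 <= s -> s <= t -> t <= a -> chi t = chi s.
Proof.
move=> h.
have half m : forall s t, 0 <= s -> s <= t -> t <= a ->
    `|chi t - chi s| <= K * (t - s) ^+ 2 / 2 ^+ m.
  elim: m => [|m IH] s t s0 st ta; first by rewrite expr0 divr1; exact: h.
  pose c := (s + t) / 2.
  have sc : s <= c by rewrite /c; lra.
  have ct : c <= t by rewrite /c; lra.
  have -> : chi t - chi s = (chi t - chi c) + (chi c - chi s) by ring.
  apply: le_trans (ler_normD _ _) _.
  have h1 := IH c t (le_trans s0 sc) ct ta.
  have h2 := IH s c s0 sc (le_trans ct ta).
  apply: le_trans (lerD h1 h2) _.
  rewrite le_eqVlt; apply/orP; left; apply/eqP.
  have p0 : (2 : R) ^+ m != 0 by rewrite expf_neq0 // pnatr_eq0.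
  by rewrite /c (exprS 2 m); field; rewrite p0.
move=> s t s0 st ta; apply/eqP; rewrite -subr_eq0 -normr_le0.
apply/ler_addgt0Pr => e e0; rewrite add0r.
set B := K * (t - s) ^+ 2.
have [m hm] : exists m : nat, `|B| / e < m%:R.
  by exists (Num.bound (`|B| / e)); rewrite archi_boundP // divr_ge0 // ltW.
apply: le_trans (half m _ _ s0 st ta) _; rewrite -/B.
rewrite ler_pdivrMr ?exprn_gt0 //.
apply: le_trans (ler_norm _) _.
rewrite mulrC -ler_pdivrMr //; apply: le_trans (ltW hm) _.
by rewrite -natrX ler_nat ltnW // ltn_expl.
Qed.

(** [phi' = psi] in integrated form. As [psi] is only measurable, [phi] need not be differentiable
    at a given time, but it is Lipschitz on [[0, a]], and that suffices for the calculus below. *)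
Definition primitive a phi psi : Prop :=
  bmf a psi /\
  forall s t, 0 <= s -> s <= t -> t <= a -> phi t - phi s = itg psi s t.

Section PrimitiveTheory.
Variable a : R.

Lemma prim_lip phi psi : primitive a phi psi -> exists2 C : R, 0 <= C &
  forall s t, 0 <= s <= a -> 0 <= t <= a -> `|phi t - phi s| <= C * `|t - s|.
Proof.
move=> [hb hi]; have [C C0 hC] := bmf_bound hb.
exists C => //.
have H s t : 0 <= s <= a -> 0 <= t <= a -> s <= t -> `|phi t - phi s| <= C * `|t - s|.
  move=> /andP[s0 sa] /andP[t0 ta] st; rewrite hi //.
  rewrite (ger0_norm (_ : 0 <= t - s)) ?subr_ge0 //.
  apply: (@le_norm_itg a) => // u /andP[su ut]; apply: hC.
  by rewrite (le_trans s0 su) (le_trans ut ta).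
move=> s t hs ht; case: (leP s t) => [st|/ltW ts]; first exact: H.
by rewrite distrC (distrC t); exact: H.
Qed.

Lemma lip_bmf phi C :
  (forall s t, 0 <= s <= a -> 0 <= t <= a -> `|phi t - phi s| <= C * `|t - s|) ->
  bmf a phi.
Proof.
move=> h; split; last first.
  exists (`|phi 0| + `|C| * a) => x hx.
  have a0 : 0 <= a by case/andP: hx => [x0 xa]; exact: le_trans xa.
  have -> : phi x = phi 0 + (phi x - phi 0) by ring.
  apply: le_trans (ler_normD _ _) _; rewrite lerD2l.
  have := h 0 x; rewrite lexx a0 => /(_ isT hx) /le_trans; apply.
  rewrite subr0; case/andP: (hx) => x0 xa; rewrite (ger0_norm x0).
  by apply: le_trans (ler_wpM2r x0 (ler_norm C)) _; rewrite ler_wpM2l.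
apply: subspace_continuous_measurable_fun => //.
apply/subspace_continuousP => x; rewrite /= in_itv /= => hx.
apply/cvgrPdist_le => e e0.
have C1 : 0 < `|C| + 1 by rewrite ltr_wpDl.
rewrite near_withinE; near=> y.
rewrite /= in_itv /= => hy.
apply: le_trans (h y x hy hx) _.
apply: (@le_trans _ _ ((`|C| + 1) * `|x - y|)).
  by rewrite ler_wpM2r // (le_trans (ler_norm _)) // lerDl.
rewrite mulrC -ler_pdivlMr //.
near: y; apply: cvgr_dist_le; first exact: cvg_id.
by rewrite divr_gt0.
Unshelve. all: by end_near. Qed.

Lemma prim_bmf phi psi : primitive a phi psi -> bmf a phi.
Proof. by move=> /prim_lip[C _ hC]; exact: (@lip_bmf _ C). Qed.

Lemma prim_cst c : primitive a (fun=> c) (fun=> 0).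
Proof.
split; first exact: bmf_cst.
by move=> s t s0 st ta; rewrite itg_cst // mul0r subrr.
Qed.

Lemma primD f1 g1 f2 g2 : primitive a f1 g1 -> primitive a f2 g2 ->
  primitive a (fun x => f1 x + f2 x) (fun x => g1 x + g2 x).
Proof.
move=> [b1 h1] [b2 h2]; split; first exact: bmfD.
move=> s t s0 st ta; rewrite (@itgD a) // -h1 // -h2 //; ring.
Qed.

Lemma primN f1 g1 : primitive a f1 g1 ->
  primitive a (fun x => - f1 x) (fun x => - g1 x).
Proof.
move=> [b1 h1]; split; first exact: bmfN.
by move=> s t s0 st ta; rewrite (@itgN a) // -h1 // opprB opprK addrC.
Qed.

Lemma primZ c f1 g1 : primitive a f1 g1 ->
  primitive a (fun x => c * f1 x) (fun x => c * g1 x).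
Proof.
move=> [b1 h1]; split; first exact: bmfZ.
by move=> s t s0 st ta; rewrite (@itgZ a) // -h1 // mulrBr.
Qed.

Lemma prim_sum (I : eqType) (r : seq I) (F G : I -> R -> R) :
  (forall i, i \in r -> primitive a (F i) (G i)) ->
  primitive a (fun x => \sum_(i <- r) F i x) (fun x => \sum_(i <- r) G i x).
Proof.
move=> h; split; first by apply: bmf_sum => i /h[].
move=> s t s0 st ta; rewrite (@itg_sum a) //; last by move=> i /h[].
rewrite -sumrB; apply: eq_big_seq => i /h[_ ->] //.
Qed.

Lemma prim_eq f1 g1 f2 g2 : (forall x, 0 <= x <= a -> f1 x = f2 x) ->
  (forall x, 0 <= x <= a -> g1 x = g2 x) ->
  primitive a f1 g1 -> primitive a f2 g2.
Proof.
move=> ef eg [[mg [C hC]] h]; split.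
  split; last by exists C => x hx; rewrite -eg // hC.
  by apply: eq_measurable_fun mg => x; rewrite inE /= in_itv /= => hx; exact: eg.
move=> s t s0 st ta; rewrite -!ef ?s0 ?ta ?(le_trans s0) ?(le_trans st) // h //.
apply: eq_itg => u /andP[su ut]; apply: eg.
by rewrite (le_trans s0) // (le_trans ut).
Qed.

Lemma prim_itg f : bmf a f -> primitive a (itg f 0) f.
Proof.
move=> hf; split => // s t s0 st ta.
by rewrite (@itg_chasles a _ 0 s t) // addrC addKr.
Qed.

Lemma prim_itg_tail f : bmf a f -> primitive a (fun s => itg f s a) (fun x => - f x).
Proof.
move=> hf; split; first exact: bmfN.
move=> s t s0 st ta; rewrite (@itgN a) // (@itg_chasles a _ s t a) //.
by rewrite opprD addrCA subrr addr0.
Qed.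

(** The difference [chi] between [F (phi t)] and the candidate integral has increments of order
    [(t - s)^2]: the Taylor remainder of [F] and the integrated variation of [F' (phi)] are both of
    that order. Hence [chi] is constant. *)
Lemma prim_chain (F F' : R -> R) lo hi K phi psi :
  (forall x y, lo <= x <= hi -> lo <= y <= hi ->
     `|F y - F x - F' x * (y - x)| <= K * (y - x) ^+ 2) ->
  (forall x y, lo <= x <= hi -> lo <= y <= hi -> `|F' y - F' x| <= K * `|y - x|) ->
  0 <= K ->
  (forall t, 0 <= t <= a -> lo <= phi t <= hi) ->
  primitive a phi psi ->
  primitive a (fun t => F (phi t)) (fun t => F' (phi t) * psi t).
Proof.
move=> hF hF' K0 hphi hp.
have [C C0 hC] := prim_lip hp.
have bF' : bmf a (fun t => F' (phi t)).
  apply: (@lip_bmf _ (K * C)) => s t hs ht.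
  apply: le_trans (hF' _ _ (hphi s hs) (hphi t ht)) _.
  by rewrite -mulrA ler_wpM2l // hC.
have [bpsi hi_] := hp.
have [D D0 hD] := bmf_bound bpsi.
have bprod := bmfM bF' bpsi.
split=> // s t s0 st ta.
pose chi x := F (phi x) - itg (fun u => F' (phi u) * psi u) 0 x.
suff : chi t = chi s.
  rewrite /chi => /eqP; rewrite subr_eq => /eqP ->.
  by rewrite (@itg_chasles a _ 0 s t) //; ring.
apply: (@quadratic_increments_cst chi a (K * C ^+ 2 + K * C * D)) => //.
move=> {s t s0 st ta} s t s0 st ta.
have hs : 0 <= s <= a by rewrite s0 (le_trans st).
have ht : 0 <= t <= a by rewrite ta (le_trans s0).
have -> : chi t - chi s = (F (phi t) - F (phi s) - F' (phi s) * (phi t - phi s))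
    + itg (fun u => (F' (phi s) - F' (phi u)) * psi u) s t.
  rewrite /chi (@itg_chasles a _ 0 s t) //.
  have -> : itg (fun u => (F' (phi s) - F' (phi u)) * psi u) s t =
      F' (phi s) * itg psi s t - itg (fun u => F' (phi u) * psi u) s t.
    rewrite -(@itgZ a) // -(@itgB a) //; last exact: bmfZ.
    by apply: eq_itg => u _; rewrite mulrBl.
  by rewrite hi_ //; ring.
apply: le_trans (ler_normD _ _) _; rewrite mulrDl; apply: lerD.
  apply: le_trans (hF _ _ (hphi s hs) (hphi t ht)) _.
  rewrite -mulrA ler_wpM2l // -exprMn -real_normK ?num_real //.
  rewrite lerXn2r ?nnegrE //.
    by rewrite mulr_ge0 // subr_ge0.
  by have := hC s t hs ht; rewrite [X in _ * X]ger0_norm ?subr_ge0.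
rewrite [X in _ <= _ * X]expr2 mulrA.
apply: (@le_norm_itg a) => //.
  by apply: bmfM => //; apply: bmfB => //; exact: bmf_cst.
move=> u /andP[su ut].
have hu : 0 <= u <= a by rewrite (le_trans s0) // (le_trans ut).
rewrite normrM distrC.
apply: (@le_trans _ _ (K * (C * (t - s)) * D)); last first.
  by rewrite le_eqVlt; apply/orP; left; apply/eqP; ring.
apply: ler_pM => //; last exact: hD.
apply: le_trans (hF' _ _ (hphi s hs) (hphi u hu)) _.
rewrite ler_wpM2l //; apply: le_trans (hC s u hs hu) _.
by rewrite ler_wpM2l // ger0_norm ?subr_ge0 // lerD2r.
Qed.

Lemma prim_sqr phi psi : primitive a phi psi ->
  primitive a (fun t => phi t ^+ 2) (fun t => 2 * phi t * psi t).
Proof.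
move=> hp; have [C _ hC] := bmf_bound (prim_bmf hp).
apply: (@prim_chain (fun x => x ^+ 2) (fun x => 2 * x) (- C) C 2) => //.
- move=> x y _ _.
  have -> : y ^+ 2 - x ^+ 2 - 2 * x * (y - x) = (y - x) ^+ 2 by ring.
  by rewrite ger0_norm ?sqr_ge0 // ler_peMl ?sqr_ge0 // ler1n.
- by move=> x y _ _; rewrite -mulrBr normrM ger0_norm.
- by move=> t /hC; rewrite ler_norml.
Qed.

(** Polarization, [4 f g = (f + g)^2 - (f - g)^2], reduces the product rule to the chain rule for
    the square. *)
Lemma primM f1 g1 f2 g2 : primitive a f1 g1 -> primitive a f2 g2 ->
  primitive a (fun x => f1 x * f2 x) (fun x => g1 x * f2 x + f1 x * g2 x).
Proof.
move=> h1 h2.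
have h3 := primZ (4^-1) (primD (prim_sqr (primD h1 h2))
  (primN (prim_sqr (primD h1 (primN h2))))).
by apply: prim_eq h3 => x _ /=; field.
Qed.

Lemma primX f1 g1 k : primitive a f1 g1 ->
  primitive a (fun x => f1 x ^+ k) (fun x => k%:R * f1 x ^+ k.-1 * g1 x).
Proof.
move=> h; elim: k => [|k IH].
  by apply: prim_eq (prim_cst 1) => x _; rewrite ?expr0 // !mul0r.
apply: prim_eq (primM h IH) => x _; first by rewrite exprS.
case: k {IH} => [|k] /=; first by rewrite !expr0; ring.
by rewrite exprS -[k.+2]addn1 natrD; ring.
Qed.

Lemma prim_inv lo phi psi : 0 < lo -> (forall t, 0 <= t <= a -> lo <= phi t) ->
  primitive a phi psi ->
  primitive a (fun t => (phi t)^-1) (fun t => - (phi t) ^- 2 * psi t).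
Proof.
move=> lo0 hlo hp; have [C _ hC] := bmf_bound (prim_bmf hp).
have P x : lo <= x -> 0 < x by apply: lt_le_trans.
have Pi x : lo <= x -> x^-1 <= lo^-1 by move=> lx; rewrite lef_pV2 // posrE // P.
have Pi0 x : lo <= x -> 0 <= x^-1 by move=> lx; rewrite invr_ge0 ltW // P.
apply: (@prim_chain (fun x => x^-1) (fun x => - x ^- 2) lo C (2 * lo^-1 ^+ 3)) => //.
- move=> x y /andP[lx _] /andP[ly _].
  have x0 := lt0r_neq0 (P x lx); have y0 := lt0r_neq0 (P y ly).
  have -> : y^-1 - x^-1 - - x ^- 2 * (y - x) = x^-1 ^+ 2 * y^-1 * (y - x) ^+ 2.
    by field; rewrite x0 y0.
  rewrite ger0_norm; last first.
    by apply: mulr_ge0; [apply: mulr_ge0; [exact: sqr_ge0 | exact: Pi0] | exact: sqr_ge0].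
  rewrite ler_wpM2r ?sqr_ge0 // [lo^-1 ^+ 3]exprSr mulrA.
  apply: ler_pM; rewrite ?sqr_ge0 ?Pi0 ?Pi //.
  apply: (@le_trans _ _ (lo^-1 ^+ 2)).
    by rewrite lerXn2r ?nnegrE ?Pi0 ?Pi.
  by rewrite ler_peMl ?sqr_ge0 // ler1n.
- move=> x y /andP[lx _] /andP[ly _].
  have x0 := lt0r_neq0 (P x lx); have y0 := lt0r_neq0 (P y ly).
  have -> : - y ^- 2 - - x ^- 2 = (x^-1 ^+ 2 * y^-1 + x^-1 * y^-1 ^+ 2) * (y - x).
    by field; rewrite x0 y0.
  rewrite normrM ler_wpM2r // ger0_norm; last first.
    by apply: addr_ge0; apply: mulr_ge0; rewrite ?sqr_ge0 ?Pi0.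
  rewrite mulrDl mul1r; apply: lerD.
    by rewrite [lo^-1 ^+ 3]exprSr; apply: ler_pM; rewrite ?sqr_ge0 ?Pi0 ?Pi // lerXn2r ?nnegrE ?Pi0 ?Pi.
  by rewrite [lo^-1 ^+ 3]exprS; apply: ler_pM; rewrite ?sqr_ge0 ?Pi0 ?Pi // lerXn2r ?nnegrE ?Pi0 ?Pi.
- by rewrite mulr_ge0 // exprn_ge0 // invr_ge0 ltW.
- by move=> t ht; rewrite hlo // (le_trans (ler_norm _)) // hC.
Qed.

Lemma expR_taylor1 (h : R) : `|expR h - 1 - h| <= h ^+ 2 * expR `|h|.
Proof.
have e1 := @expR_ge1Dx R h; have e2 := @expR_ge1Dx R (- h).
rewrite ger0_norm; last lra.
(* From [1 - h <= expR (- h)]. It gives [expR h - 1 <= h * expR h], which is applied a second time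
   when [h >= 0]. *)
have e3 : 1 >= expR h * (1 - h).
  by rewrite -[leRHS](expRxMexpNx_1 h) ler_wpM2l // expR_ge0.
apply: (@le_trans _ _ (h * (expR h - 1))); first by lra.
have [h0|h0] := leP 0 h.
  rewrite ger0_norm // expr2 -mulrA ler_wpM2l //; lra.
have : 1 <= expR `|h| by rewrite -expR0 ler_expR.
move=> y1; apply: (@le_trans _ _ (h ^+ 2)); last by rewrite ler_peMr // sqr_ge0.
have : h * (expR h - 1 - h) <= 0 by apply: mulr_le0_ge0; [exact: ltW | lra].
by rewrite mulrBr -expr2; lra.
Qed.

Lemma prim_expR phi psi : primitive a phi psi ->
  primitive a (fun t => expR (phi t)) (fun t => expR (phi t) * psi t).
Proof.
move=> hp; have [C C0 hC] := bmf_bound (prim_bmf hp).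
pose B := expR (2 * C); pose K := expR C * (2 * C * B + 1) + expR C * B.
have hd (x y : R) : - C <= x <= C -> - C <= y <= C -> `|y - x| <= 2 * C.
  by move=> /andP[? ?] /andP[? ?]; rewrite ler_norml; apply/andP; split; lra.
have B0 : 0 <= B by exact: expR_ge0.
have hT (x y : R) : - C <= x <= C -> - C <= y <= C ->
    `|expR (y - x) - 1 - (y - x)| <= B * (y - x) ^+ 2.
  move=> hx hy; apply: le_trans (expR_taylor1 _) _.
  by rewrite mulrC ler_wpM2r ?sqr_ge0 // ler_expR hd.
have E (x y : R) : expR y = expR x * expR (y - x) by rewrite -expRD addrC subrK.
have K1 : expR C * B <= K.
  by rewrite lerDr mulr_ge0 ?expR_ge0 // addr_ge0 // !mulr_ge0.
have K2 : expR C * (2 * C * B + 1) <= K by rewrite lerDl mulr_ge0 ?expR_ge0.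
apply: (@prim_chain expR expR (- C) C K) => //.
- move=> x y hx hy; rewrite (E x y).
  have -> : expR x * expR (y - x) - expR x - expR x * (y - x) =
    expR x * (expR (y - x) - 1 - (y - x)) by ring.
  rewrite normrM (ger0_norm (expR_ge0 _)).
  apply: (@le_trans _ _ (expR C * (B * (y - x) ^+ 2))).
    by apply: ler_pM; rewrite ?expR_ge0 ?hT // ler_expR; case/andP: hx.
  by rewrite mulrA ler_wpM2r // sqr_ge0.
- move=> x y hx hy; rewrite (E x y).
  have -> : expR x * expR (y - x) - expR x =
    expR x * ((expR (y - x) - 1 - (y - x)) + (y - x)) by ring.
  rewrite normrM (ger0_norm (expR_ge0 _)).
  apply: (@le_trans _ _ (expR C * ((2 * C * B + 1) * `|y - x|))); last first.
    by rewrite mulrA ler_wpM2r.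
  apply: ler_pM; rewrite ?expR_ge0 //; first by rewrite ler_expR; case/andP: hx.
  apply: le_trans (ler_normD _ _) _; rewrite mulrDl mul1r lerD2r.
  apply: le_trans (hT x y hx hy) _.
  rewrite -real_normK ?num_real // expr2 mulrA ler_wpM2r //.
  by rewrite mulrC ler_wpM2r // hd.
- by rewrite addr_ge0 ?mulr_ge0 ?expR_ge0 // addr_ge0 // !mulr_ge0.
- by move=> t /hC; rewrite ler_norml.
Qed.

End PrimitiveTheory.
End Primitives.

(** * Grids and the Markov property *)

Section Probability.
Context {R : realType} {d : measure_display} {T : measurableType d}.
Variable P : probability T R.
Implicit Types (A B : set T) (X : {RV P >-> nat}).

Lemma measurable_RV_nat X (A : set nat) : measurable [set w | A (X w)].
Proof.
have mX : measurable_fun setT X by exact: measurable_funPT.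
by have := mX measurableT A I; rewrite setTI.
Qed.

Definition pr A : R := fine (P A).

Lemma prE A : measurable A -> (pr A)%:E = P A.
Proof. by move=> mA; rewrite /pr fineK // fin_num_measure. Qed.

Lemma pr_ge0 A : 0 <= pr A.
Proof. by rewrite /pr fine_ge0. Qed.

Lemma pr_le A B : measurable A -> measurable B -> A `<=` B -> pr A <= pr B.
Proof.
by move=> mA mB AB; rewrite -lee_fin !prE // le_measure // inE.
Qed.

Lemma prT : pr setT = 1.
Proof. by rewrite /pr probability_setT. Qed.

Lemma pr_le1 A : measurable A -> pr A <= 1.
Proof. by move=> mA; rewrite -prT pr_le. Qed.

Lemma pr_gt0 A : measurable A -> (0 < P A)%E = (0 < pr A).
Proof. by move=> mA; rewrite -prE // lte_fin. Qed.

Lemma prU A B : measurable A -> measurable B -> A `&` B = set0 ->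
  pr (A `|` B) = pr A + pr B.
Proof.
move=> mA mB AB; apply: EFin_inj; rewrite EFinD !prE ?measureU //.
exact: measurableU.
Qed.

Lemma pr_sum_lt B X N : measurable B ->
  pr (B `&` [set w | (X w < N)%N]) = \sum_(i < N) pr (B `&` [set w | X w = i]).
Proof.
move=> mB; have mm (A : set nat) : measurable (B `&` [set w | A (X w)]).
  by apply: measurableI => //; exact: measurable_RV_nat.
elim: N => [|N IH].
  rewrite big_ord0 /pr (_ : _ `&` _ = set0) ?measure0 //.
  by apply/seteqP; split => // w [].
rewrite big_ord_recr /= -IH -prU //.
- congr pr; apply/seteqP; split => w /=.
    by move=> [Bw]; rewrite ltnS leq_eqVlt => /orP[/eqP|]; [right | left].
  by move=> [[Bw h]|[Bw ->]] //; split => //; exact: ltnW.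
- exact: (mm [set i | (i < N)%N]).
- exact: (mm [set N]).
- by apply/seteqP; split => // w /= [[_ h] [_ e]]; rewrite e ltnn in h.
Qed.

Lemma pr_sum_lt1 X N : \sum_(i < N) pr [set w | X w = i] <= 1.
Proof.
have := pr_sum_lt X N (@measurableT _ T); rewrite setTI => h.
rewrite (eq_bigr (fun i : 'I_N => pr (setT `&` [set w | X w = i]))); last first.
  by move=> i _; rewrite setTI.
by rewrite -h; apply: pr_le1; exact: (measurable_RV_nat X [set i | (i < N)%N]).
Qed.

End Probability.

Section Markov.
Context {R : realType} {d : measure_display} {T : measurableType d}.
Context {P : probability T R} (Z : R -> {RV P >-> nat}).
Hypothesis markovZ : markov_property Z.

Definition transition (s t : R) (i j : nat) : R :=
  cprob P [set w | Z t w = j] [set w | Z s w = i].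

Definition past (h : seq (R * nat)) : set T :=
  [set w | forall p, p \in h -> Z p.1 w = p.2].

Definition below (ts : seq R) (N : nat) : set T :=
  [set w | forall v, v \in ts -> (Z v w < N)%N].

Lemma past_cons p h : past (p :: h) = [set w | Z p.1 w = p.2] `&` past h.
Proof.
apply/seteqP; split => w /=.
  by move=> hp; split; [apply: hp; rewrite mem_head | move=> q qh; apply: hp; rewrite inE qh orbT].
by move=> [hp hh] q; rewrite inE => /predU1P[->|/hh].
Qed.

Lemma below_cons v ts N : below (v :: ts) N = [set w | (Z v w < N)%N] `&` below ts N.
Proof.
apply/seteqP; split => w /=.
  by move=> hp; split; [apply: hp; rewrite mem_head | move=> q qh; apply: hp; rewrite inE qh orbT].
by move=> [hp hh] q; rewrite inE => /predU1P[->|/hh].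
Qed.

Lemma measurable_past h : measurable (past h).
Proof.
elim: h => [|p h IH]; last first.
  by rewrite past_cons; apply: measurableI => //; exact: (measurable_RV_nat _ [set p.2]).
by rewrite (_ : past _ = setT) //; apply/seteqP; split.
Qed.

Lemma measurable_below ts N : measurable (below ts N).
Proof.
elim: ts => [|v ts IH]; last first.
  by rewrite below_cons; apply: measurableI => //; exact: (measurable_RV_nat _ [set i | (i < N)%N]).
by rewrite (_ : below _ _ = setT) //; apply/seteqP; split.
Qed.

(** [markov_property] conditions on exact past states only. By induction on [ts], the event that
    [Z v] is below [N] is split over its finitely many values, and each value joins the exact past
    [h]. *)
Lemma markov_below ts h s t i j N :
  (forall v, v \in ts -> 0 <= v <= s) -> (forall p, p \in h -> 0 <= p.1 <= s) ->
  0 <= s -> s <= t ->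
  pr P ([set w | Z t w = j] `&` ([set w | Z s w = i] `&` (below ts N `&` past h))) =
  pr P ([set w | Z s w = i] `&` (below ts N `&` past h)) * transition s t i j.
Proof.
move=> hts hh s0 st.
have mj : measurable [set w | Z t w = j] by exact: (measurable_RV_nat _ [set j]).
have mi : measurable [set w | Z s w = i] by exact: (measurable_RV_nat _ [set i]).
elim: ts h hts hh => [|v ts IH] h hts hh.
  have -> : below [::] N = setT by apply/seteqP; split.
  rewrite setTI.
  have mp := measurable_past h.
  have mip : measurable ([set w | Z s w = i] `&` past h) by exact: measurableI.
  have mjip := measurableI _ _ mj mip.
  have [P0|] := ltP 0 (pr P ([set w | Z s w = i] `&` past h)); last first.
    (* On a null conditioning event [markov_property] is silent; both sides then vanish. *)
    move=> P0; have {}P0 : pr P ([set w | Z s w = i] `&` past h) = 0.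
      by apply/eqP; rewrite eq_le P0 pr_ge0.
    rewrite P0 mul0r; apply/eqP; rewrite eq_le pr_ge0 andbT -P0.
    by apply: pr_le => // w [].
  have := @markovZ h s t i j hh s0 st => /=.
  rewrite -/(past h) pr_gt0 // => /(_ P0).
  rewrite -/(transition s t i j) => <-.
  by rewrite /cprob -/(pr P _) -/(pr P _) mulrC divfK // gt_eqF.
have split_v (A : set T) : measurable A ->
    pr P (A `&` (below (v :: ts) N `&` past h)) =
    \sum_(x < N) pr P (A `&` (below ts N `&` past ((v, val x) :: h))).
  move=> mA; have -> : A `&` (below (v :: ts) N `&` past h) =
     (A `&` (below ts N `&` past h)) `&` [set w | (Z v w < N)%N].
    by rewrite below_cons -!setIA; congr (_ `&` _); rewrite setIC setIA.
  rewrite pr_sum_lt; last first.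
    apply: measurableI => //; apply: measurableI; first exact: measurable_below.
    exact: measurable_past.
  apply: eq_bigr => x _; rewrite past_cons /=; congr pr.
  by rewrite -!setIA; do 2 congr (_ `&` _); rewrite setIC.
rewrite setIA !split_v //; last exact: measurableI.
rewrite mulr_suml; apply: eq_bigr => x _; rewrite -setIA; apply: IH.
  by move=> u uts; apply: hts; rewrite inE uts orbT.
move=> p; rewrite inE => /predU1P[->|/hh//] /=.
by apply: hts; rewrite mem_head.
Qed.

End Markov.

Lemma near_all_seq {U : Type} (F : set_system U) {FF : Filter F} (I : eqType)
    (r : seq I) (Q : I -> U -> Prop) :
  (forall i, i \in r -> \forall x \near F, Q i x) ->
  \forall x \near F, forall i, i \in r -> Q i x.
Proof.
elim: r => [|i r IH] h; first by apply: filterE.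
have h1 := h i (mem_head _ _).
have h2 : \forall x \near F, forall j, j \in r -> Q j x.
  by apply: IH => j jr; apply: h; rewrite inE jr orbT.
by apply: filterS2 h1 h2 => x h1 h2 j; rewrite inE => /predU1P[->|/h2].
Qed.

Lemma sumr_const_seq {V : nmodType} (I : Type) (r : seq I) (x : V) :
  \sum_(i <- r) x = x *+ size r.
Proof. by rewrite big_const_seq count_predT iter_addr_0. Qed.

(** * Supersolutions of the forward equation *)

Section JumpPath.
Context {R : realType}.

(** Compactness of [[0, a]], through the supremum [s] of the times up to which the path is bounded:
    the left limit at [s] bounds the path before [s], and right-continuity carries the bound past
    [s]. *)
Lemma jump_path_bounded (z : R -> nat) (a : R) : jump_path z -> 0 <= a ->
  exists N : nat, forall u, 0 <= u <= a -> (z u < N)%N.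
Proof.
move=> hz a0.
pose S := [set x : R | 0 <= x <= a /\ exists N : nat, forall u, 0 <= u <= x -> (z u < N)%N].
have S0 : S 0.
  split; first by rewrite lexx a0.
  exists (z 0).+1 => u hu; have -> : u = 0 by apply/eqP; rewrite eq_le andbC.
  by [].
have hS : has_sup S.
  by split; [exists 0 | exists a => x [/andP[_ xa] _]].
pose s := sup S.
have s0 : 0 <= s by exact: (ub_le_sup hS.2).
have sa : s <= a by apply: ge_sup; [exists 0 | move=> x [/andP[_ xa] _]].
have [hr hl] := hz s s0.
have [dr dr0 hdr] : exists2 e : R, 0 < e & forall u, s < u -> u < s + e -> z u = z s.
  have [e /= e0 he] := hr; exists e => // u su ue; apply: he => //=.
  by rewrite /ball_ /= distrC gtr0_norm ?subr_gt0 //; lra.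
have [N hN] : exists N : nat, forall u, 0 <= u -> u < s -> (z u < N)%N.
  move: s0; rewrite le_eqVlt => /predU1P[s0|s0].
    by exists 0%N => u u0 us; exfalso; lra.
  have [i [e /= e0 he]] := hl s0.
  have [x [_ [N hN]] sx] := sup_adherent e0 hS.
  exists (maxn N i.+1) => u u0 us; rewrite leq_max.
  have [ux|xu] := leP u x; first by rewrite hN // u0.
  apply/orP; right; rewrite he //= /ball_ /= gtr0_norm ?subr_gt0 //.
  by move: sx; rewrite -/s; lra.
(* Half of [dr] keeps [y] inside the interval of constancy; were [y] not equal to [a], it would
   exceed [s]. *)
pose y := Num.min a (s + dr / 2).
have Sy : S y.
  split; first by rewrite /y ge_min lexx le_min a0 /= addr_ge0 // divr_ge0 // ltW.
  exists (maxn N (z s).+1) => u /andP[u0]; rewrite /y le_min => /andP[_ usd].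
  rewrite leq_max; have [us|su|->] := ltgtP u s; last by rewrite leqnn orbT.
    by rewrite hN.
  by rewrite hdr ?leqnn ?orbT //; lra.
have ys : y <= s by exact: (ub_le_sup hS.2).
have ya : y = a.
  move: ys; rewrite /y; case: (leP a (s + dr / 2)) => // _; lra.
by case: Sy => _; rewrite ya.
Qed.

End JumpPath.

(* The absolute value is harmless: it differs from i + k only at i = 0, where all
   rates vanish. *)
Definition target (i : nat) (k : int) : nat := absz (i%:Z + k).

(** * One time step of the process *)

Section Dynkin.
Context {R : realType} {d : measure_display} {T : measurableType d}.
Context {P : probability T R} (Z : R -> {RV P >-> nat}).
Variables (n : nat) (b : int -> R -> R).
Hypothesis b_bmf : forall a k, k \in jumps n -> bmf a (b k).
Hypothesis bdZ : birth_death_process n b Z.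

Lemma total_rateE u : total_rate n b u = \sum_(k <- jumps n) b k u.
Proof.
rewrite /total_rate /birth_rate /jumps big_cons big_map.
by rewrite /index_iota subSS subn0.
Qed.

Lemma jumps_size : size (jumps n) = n.+1.
Proof. by rewrite /= size_map size_iota. Qed.

Lemma jumpsP k : k \in jumps n -> k = -1 \/ exists2 m : nat, (1 <= m <= n)%N & k = m%:Z.
Proof.
rewrite inE => /predU1P[->|/mapP[m]]; first by left.
by rewrite mem_iota add1n ltnS => hm ->; right; exists m.
Qed.

Lemma targetE i k : k \in jumps n -> (0 < i)%N -> (target i k)%:Z = i%:Z + k.
Proof.
move=> /jumpsP[->|[m _ ->]] i0; rewrite /target; last by [].
by case: i i0 => // i _; lia.
Qed.

Lemma target_le i k : k \in jumps n -> (target i k <= i + n.+1)%N.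
Proof. by move=> /jumpsP[->|[m hm ->]]; rewrite /target; lia. Qed.

Lemma uniq_targets i : (0 < i)%N -> uniq (i :: [seq target i k | k <- jumps n]).
Proof.
move=> i0; rewrite cons_uniq; apply/andP; split.
  apply/negP => /mapP[k kj e]; have := targetE kj i0; rewrite -e.
  by case: (jumpsP kj) => [->|[m hm ->]]; lia.
rewrite map_inj_in_uniq.
  rewrite /jumps /=; apply/andP; split; first by apply/negP => /mapP[].
  by rewrite map_inj_uniq ?iota_uniq // => x y [].
by move=> k l kj lj e; have := targetE kj i0; rewrite e targetE // => /addrI.
Qed.

(** Outside [S] only the remaining mass is left, and it is weighted by at most [G]. The auxiliary
    range [M] covers both [S] and the states below [N], since [S] may reach beyond [N]. *)
Lemma sum_outside (g p : nat -> R) (N : nat) (G : R) (S : seq nat) : uniq S ->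
  (forall j, 0 <= g j) -> (forall j, (j < N)%N -> g j <= G) -> 0 <= G ->
  (forall j, 0 <= p j) -> (forall M, \sum_(j < M) p j <= 1) ->
  \sum_(j < N) g j * p j <= \sum_(j <- S) g j * p j + G * (1 - \sum_(j <- S) p j).
Proof.
move=> uS g0 gG G0 p0 p1.
pose M := (N + \max_(j <- S) j).+1.
have SM j : j \in S -> (j < M)%N.
  by move=> jS; rewrite ltnS; apply: leq_trans (leq_addl _ _); exact: leq_bigmax_seq.
have sumS (F : nat -> R) : \sum_(j < M | val j \in S) F j = \sum_(j <- S) F j.
  rewrite -(big_mkord (fun j => j \in S) F) -big_filter; apply: perm_big.
  apply: uniq_perm => //; first by rewrite filter_uniq // iota_uniq.
  move=> j; rewrite mem_filter mem_index_iota /=.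
  by case jS : (j \in S) => //=; rewrite SM.
have NM : (N <= M)%N by rewrite /M; lia.
pose h j := if (j < N)%N then g j else 0.
have -> : \sum_(j < N) g j * p j = \sum_(j < M) h j * p j.
  rewrite (big_ord_widen_cond M xpredT (fun j => g j * p j)) //=.
  rewrite big_mkcond /=; apply: eq_bigr => j _; rewrite /h.
  by case: ifP => //; rewrite mul0r.
rewrite (bigID (fun j : 'I_M => val j \in S)) /=; apply: lerD.
  rewrite -sumS; apply: ler_sum => j _; rewrite ler_wpM2r // /h.
  by case: ifP.
apply: (@le_trans _ _ (\sum_(j < M | val j \notin S) G * p j)).
  by apply: ler_sum => j _; rewrite ler_wpM2r // /h; case: ifP => // /gG.
rewrite -mulr_sumr ler_wpM2l // lerBrDl -sumS.
by have := p1 M; rewrite (bigID (fun j : 'I_M => val j \in S)).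
Qed.

Lemma itg_total_rate a s t : 0 <= s -> s <= t -> t <= a ->
  itg (total_rate n b) s t = \sum_(k <- jumps n) itg (b k) s t.
Proof.
move=> s0 st ta; rewrite -(@itg_sum _ a) //; last by move=> k kj; exact: b_bmf.
by congr (itg _ _ _); apply/funext => u; exact: total_rateE.
Qed.

(** The probabilities of staying and of the [n + 1] jumps are known up to [e * D] each, so all other
    states together have mass at most [(n + 2) * e * D]. This mass and the individual errors, all
    weighted by [G], give the factor [2 * n.+2]. *)
Lemma one_step (N : nat) (a e : R) : 0 < e -> \forall D \near 0^'+,
  forall t i, 0 <= t <= a -> (i < N)%N -> (0 < P [set w | Z t w = i])%E ->
  forall (g : nat -> R) (G : R), (forall j, 0 <= g j) -> 0 <= G ->
    (forall j, (j < N + n.+1)%N -> g j <= G) ->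
  \sum_(j < N) g j * transition Z t (t + D) i j <=
   g i + i%:R * (\sum_(k <- jumps n) itg (b k) t (t + D) * (g (target i k) - g i))
   + 2 * n.+2%:R * G * e * D.
Proof.
move=> e0.
have h1 : \forall D \near 0^'+, forall i, i \in iota 0 N ->
    forall k, k \in jumps n -> forall t, 0 <= t <= a ->
      (0 < P [set w | Z t w = i])%E ->
      `| cprob P [set w | (Z (t + D) w)%:Z - (Z t w)%:Z = k] [set w | Z t w = i]
         - i%:R * itg (b k) t (t + D) | <= e * D.
  apply: near_all_seq => i _; apply: near_all_seq => k kj.
  exact: (bd_jump bdZ kj).
have h2 : \forall D \near 0^'+, forall i, i \in iota 0 N ->
    forall t, 0 <= t <= a ->
      (0 < P [set w | Z t w = i])%E ->
      `| cprob P [set w | (Z (t + D) w)%:Z - (Z t w)%:Z = 0] [set w | Z t w = i]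
         - (1 - i%:R * itg (total_rate n b) t (t + D)) | <= e * D.
  by apply: near_all_seq => i _; exact: (bd_no_jump bdZ).
have h3 : \forall D \near (0 : R)^'+, 0 < D by exact: nbhs_right_gt.
apply: filterS3 h1 h2 h3 => D h1 h2 D0 t i ht iN Pi g G g0 G0 gG.
have iN' : i \in iota 0 N by rewrite mem_iota.
have t0 : 0 <= t by case/andP: ht.
set p := transition Z t (t + D) i.
have cpE k j : (forall w, Z t w = i -> ((Z (t + D) w)%:Z - (Z t w)%:Z = k) <-> (Z (t + D) w = j)) ->
    cprob P [set w | (Z (t + D) w)%:Z - (Z t w)%:Z = k] [set w | Z t w = i] = p j.
  move=> h; rewrite /p /transition /cprob; congr (fine (P _) / _).
  by apply/seteqP; split=> w /= [h1' h2']; split=> //; apply/(h w h2').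
have mi : measurable [set w | Z t w = i] by exact: (measurable_RV_nat _ [set i]).
have Pi' : 0 < pr P [set w | Z t w = i] by rewrite -pr_gt0.
have p0 j : 0 <= p j by rewrite /p /transition /cprob divr_ge0 // pr_ge0.
have p1 M : \sum_(j < M) p j <= 1.
  rewrite /p /transition /cprob -mulr_suml ler_pdivrMr // mul1r.
  rewrite (eq_bigr (fun j : 'I_M => pr P ([set w | Z t w = i] `&` [set w | Z (t + D) w = j]))); last first.
    by move=> j _; rewrite setIC.
  rewrite -pr_sum_lt //; apply: pr_le => //.
  apply: measurableI => //; exact: (measurable_RV_nat _ [set x | (x < M)%N]).
have h0 : `|p i - (1 - i%:R * \sum_(k <- jumps n) itg (b k) t (t + D))| <= e * D.
  rewrite -(@itg_total_rate (t + D)) //; last by rewrite lerDl ltW.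
  rewrite -(cpE 0 i); first exact: h2.
  by move=> w ->; split; lia.
(* At state 0 every jump has intensity 0 and [target 0 (-1)] is not a genuine target, so the list of
   jumps is taken empty there. *)
pose K := if i is 0%N then [::] else jumps n.
have Kj k : k \in K -> k \in jumps n by rewrite /K; case: (i).
have KE (x : int -> R) : i%:R * \sum_(k <- jumps n) x k = i%:R * \sum_(k <- K) x k.
  by rewrite /K; case: (i) => //; rewrite !mul0r.
have hk k : k \in K -> `|p (target i k) - i%:R * itg (b k) t (t + D)| <= e * D.
  move=> kK; have i1 : (0 < i)%N by move: kK; rewrite /K; case: (i).
  rewrite -(cpE k (target i k)); first exact: (h1 i iN' k (Kj k kK)).
  move=> w ->; by have := targetE (Kj k kK) i1; split; lia.
pose S := i :: [seq target i k | k <- K].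
have uS : uniq S.
  by rewrite /S /K; case: (posnP i) => [->//|i1]; case: (i) i1 => // i' _; exact: uniq_targets.
have sK : (size K <= n.+1)%N by rewrite /K; case: (i) => // i'; rewrite jumps_size.
rewrite (KE (fun k => itg (b k) t (t + D))) in h0.
have /= -> := KE (fun k => itg (b k) t (t + D) * (g (target i k) - g i)).
apply: le_trans (sum_outside uS g0 _ G0 p0 p1) _.
  by move=> j jN; apply: gG; apply: leq_trans jN (leq_addr _ _).
rewrite /S 2!big_cons 2!big_map.
set E := e * D in h0 hk *.
have E0 : 0 <= E by rewrite mulr_ge0 // ltW.
have H1 : g i * p i <= g i * (1 - i%:R * \sum_(k <- K) itg (b k) t (t + D)) + G * E.
  rewrite -lerBlDl -mulrBr; apply: (@le_trans _ _ (g i * E)).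
    by rewrite ler_wpM2l // (le_trans (ler_norm _)).
  by rewrite ler_wpM2r // gG // ltn_addr.
have H2 : \sum_(k <- K) g (target i k) * p (target i k) <=
   \sum_(k <- K) g (target i k) * (i%:R * itg (b k) t (t + D)) + (size K)%:R * (G * E).
  rewrite mulr_natl -sumr_const_seq -big_split /= !big_seq; apply: ler_sum => k kK.
  rewrite -lerBlDl -mulrBr; apply: (@le_trans _ _ (g (target i k) * E)).
    by rewrite ler_wpM2l // (le_trans (ler_norm _)) // hk.
  rewrite ler_wpM2r // gG //; apply: leq_ltn_trans (target_le i (Kj _ kK)) _.
  by rewrite ltn_add2r.
have H3 : 1 - (p i + \sum_(k <- K) p (target i k)) <= (size K).+1%:R * E.
  have : \sum_(k <- K) i%:R * itg (b k) t (t + D) <= \sum_(k <- K) p (target i k) + (size K)%:R * E.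
    rewrite mulr_natl -sumr_const_seq -big_split /= !big_seq; apply: ler_sum => k kK.
    have := hk k kK; rewrite ler_norml => /andP[+ _]; lra.
  rewrite -mulr_sumr; move: h0; rewrite ler_norml => /andP[+ _].
  rewrite -[(size K).+1%:R]natr1; lra.
apply: (@le_trans _ _ (g i * (1 - i%:R * \sum_(k <- K) itg (b k) t (t + D)) + G * E +
  (\sum_(k <- K) g (target i k) * (i%:R * itg (b k) t (t + D)) + (size K)%:R * (G * E)) +
   G * ((size K).+1%:R * E))).
  by apply: lerD; [exact: lerD | rewrite ler_wpM2l].
have -> : i%:R * \sum_(k <- K) itg (b k) t (t + D) * (g (target i k) - g i) =
  \sum_(k <- K) g (target i k) * (i%:R * itg (b k) t (t + D)) -
  g i * (i%:R * \sum_(k <- K) itg (b k) t (t + D)).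
  rewrite !mulr_sumr -sumrB; apply: eq_bigr => k _; ring.
set S1 := \sum_(k <- K) g _ * _; set S2 := \sum_(k <- K) _.
have : (size K).+1%:R * (G * E) <= n.+2%:R * (G * E).
  by apply: ler_wpM2r; [exact: mulr_ge0 | rewrite ler_nat].
rewrite /E -!natr1; lra.
Qed.

End Dynkin.

Lemma common_bound {R : realDomainType} (I : eqType) (r : seq I) (Q : I -> R -> Prop) :
  (forall i x y, x <= y -> Q i x -> Q i y) ->
  (forall i, i \in r -> exists2 C, 0 <= C & Q i C) ->
  exists2 C, 0 <= C & forall i, i \in r -> Q i C.
Proof.
move=> mono; elim: r => [|i r IH] h; first by exists 0.
have [C C0 hC] := h i (mem_head _ _).
have [D D0 hD] : exists2 C, 0 <= C & forall i, i \in r -> Q i C.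
  by apply: IH => j jr; apply: h; rewrite inE jr orbT.
exists (C + D); first exact: addr_ge0.
move=> j; rewrite inE => /predU1P[->|/hD]; last by apply: mono; rewrite lerDr.
by apply: mono hC; rewrite lerDl.
Qed.

Fixpoint grid {R : realType} (D : R) (l : nat) : seq R :=
  if l is l'.+1 then l%:R * D :: grid D l' else [:: 0].

Lemma gridP {R : realType} (D : R) (l : nat) v : 0 <= D ->
  v \in grid D l -> 0 <= v <= l%:R * D.
Proof.
move=> D0; elim: l => [|l IH] /=.
  by rewrite inE => /eqP ->; rewrite mul0r lexx.
rewrite inE => /predU1P[->|/IH /andP[-> h]].
  by rewrite lexx mulr_ge0.
by rewrite (le_trans h) // ler_wpM2r // ler_nat.
Qed.

(** * From one time step to expectations at a fixed time *)

Section Dynkin.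
Context {R : realType} {d : measure_display} {T : measurableType d}.
Context {P : probability T R} (Z : R -> {RV P >-> nat}).
Variables (n : nat) (b : int -> R -> R).
Hypothesis b_bmf : forall a k, k \in jumps n -> bmf a (b k).
Hypothesis bdZ : birth_death_process n b Z.

Definition generator (f : nat -> R) (u : R) (i : nat) : R :=
  i%:R * \sum_(k <- jumps n) b k u * (f (target i k) - f i).

Section Supersolution.
Variables (a : R) (f psi : R -> nat -> R).
Hypothesis a_ge0 : 0 <= a.
Hypothesis f_ge0 : forall u i, 0 <= u <= a -> 0 <= f u i.
Hypothesis f_prim : forall i, primitive a (f ^~ i) (psi ^~ i).
Hypothesis f_gen : forall u i, 0 <= u <= a -> psi u i + generator (f u) u i <= 0.

(** Freezing [f] at time [t + D] inside the generator costs [O(D^2)]: over [[t, t + D]] the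
    differences of [f] move by at most [2 * L * D], and each rate integrates to at most [B * D]. *)
Lemma supersolution_drift (N : nat) : exists2 C : R, 0 <= C &
  forall t D i, 0 <= t -> 0 <= D -> t + D <= a -> (i < N)%N ->
  f (t + D) i + i%:R * (\sum_(k <- jumps n) itg (b k) t (t + D) *
     (f (t + D) (target i k) - f (t + D) i)) <= f t i + C * D ^+ 2.
Proof.
have [B B0 hB] : exists2 B : R, 0 <= B & forall k, k \in jumps n ->
    forall u, 0 <= u <= a -> `|b k u| <= B.
  apply: common_bound => [k x y xy h u hu|k kj]; first exact: le_trans (h u hu) xy.
  exact: bmf_bound (b_bmf a kj).
(* From below [N] one jump stays below [N + n.+1], so only finitely many Lipschitz constants
   matter. *)
have [L L0 hL] : exists2 L : R, 0 <= L & forall j, j \in iota 0 (N + n.+1) ->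
    forall s t, 0 <= s <= a -> 0 <= t <= a -> `|f t j - f s j| <= L * `|t - s|.
  apply: common_bound => [k x y xy h s t hs ht|k _].
    by apply: le_trans (h s t hs ht) _; rewrite ler_wpM2r.
  exact: prim_lip (f_prim k).
exists (N%:R * (n.+1%:R * (B * (2 * L)))); first by rewrite !mulr_ge0.
move=> t D i t0 D0 tD iN.
have tt : t <= t + D by rewrite lerDl.
have bb k : k \in jumps n -> bmf a (b k) by exact: b_bmf.
have bf j : bmf a (f ^~ j) := prim_bmf (f_prim j).
have bd k : k \in jumps n -> bmf a (fun u => b k u * (f u (target i k) - f u i)).
  by move=> kj; apply: bmfM; [exact: bb | exact: bmfB].
have [bpsi hpsi] := f_prim i.
have : itg (fun u => psi u i + generator (f u) u i) t (t + D) <= 0.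
  apply: (@le_trans _ _ (itg (fun=> 0) t (t + D))); last by rewrite itg_cst // mul0r.
  apply: (@le_itg _ a) => //; last 1 first.
  - by move=> u /andP[tu ut]; apply: f_gen; rewrite (le_trans t0) // (le_trans ut).
  - by apply: bmfD => //; apply: bmfZ; apply: bmf_sum.
  - exact: bmf_cst.
rewrite /generator (@itgD _ a) //; last by apply: bmfZ; apply: bmf_sum.
rewrite (@itgZ _ a) //; last exact: bmf_sum.
rewrite (@itg_sum _ a) // -hpsi //.
set S1 := \sum_(k <- _) _; set S2 := \sum_(k <- _) _ => hS.
suff : i%:R * (S2 - S1) <= N%:R * (n.+1%:R * (B * (2 * L))) * D ^+ 2 by rewrite mulrBr; lra.
apply: (@le_trans _ _ (i%:R * (n.+1%:R * (B * (2 * L)) * D ^+ 2))); last first.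
  rewrite mulrA ler_wpM2r ?sqr_ge0 // ler_wpM2r ?mulr_ge0 // ler_nat.
  exact: ltnW.
rewrite ler_wpM2l // /S1 /S2 -sumrB.
have -> : n.+1%:R * (B * (2 * L)) * D ^+ 2 = \sum_(k <- jumps n) B * (2 * L) * D ^+ 2.
  by rewrite sumr_const_seq jumps_size -mulrA mulr_natl.
rewrite !big_seq; apply: ler_sum => k kj.
set c := f (t + D) (target i k) - f (t + D) i.
have bc : bmf a (fun u => c * b k u) by exact/bmfZ/bb.
have -> : itg (b k) t (t + D) * c = itg (fun u => c * b k u) t (t + D).
  by rewrite (@itgZ _ a c (b k) _ _ (bb k kj) t0 tD) mulrC.
rewrite -(@itgB _ a _ _ _ _ bc (bd k kj) t0 tD).
apply: le_trans (ler_norm _) _.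
have -> : B * (2 * L) * D ^+ 2 = B * (2 * L * D) * ((t + D) - t) by ring.
apply: (@le_norm_itg _ a) => //; first by apply: bmfB; [exact: bc | exact: bd].
move=> u /andP[tu ut].
have hu : 0 <= u <= a by rewrite (le_trans t0) // (le_trans ut).
have hD : 0 <= t + D <= a by rewrite tD addr_ge0.
have -> : c * b k u - b k u * (f u (target i k) - f u i)
  = b k u * ((f (t + D) (target i k) - f u (target i k)) - (f (t + D) i - f u i)).
  by rewrite /c; ring.
rewrite normrM; apply: ler_pM => //; first exact: hB.
apply: le_trans (ler_normB _ _) _.
have uD : `|t + D - u| <= D by rewrite ger0_norm ?subr_ge0 //; lra.
have hj j : (j < N + n.+1)%N -> `|f (t + D) j - f u j| <= L * D.
  move=> jN; have jN' : j \in iota 0 (N + n.+1) by rewrite mem_iota.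
  by apply: le_trans (hL j jN' u (t + D) hu hD) _; rewrite ler_wpM2l.
have h1 : (target i k < N + n.+1)%N.
  by apply: leq_ltn_trans (target_le i kj) _; rewrite ltn_add2r.
have h2 : (i < N + n.+1)%N by rewrite ltn_addr.
have := hj _ h1; have := hj _ h2; lra.
Qed.

Lemma supersolution_step (N : nat) (e : R) : 0 < e -> \forall D \near 0^'+,
  forall t i, 0 <= t -> t + D <= a -> (i < N)%N -> (0 < P [set w | Z t w = i])%E ->
  \sum_(j < N) f (t + D) j * transition Z t (t + D) i j <= f t i + e * D.
Proof.
move=> e0; have [C C0 hC] := supersolution_drift N.
have [G G0 hG] : exists2 G : R, 0 <= G & forall j, j \in iota 0 (N + n.+1) ->
    forall u, 0 <= u <= a -> `|f u j| <= G.
  apply: common_bound => [k x y xy h u hu|k _]; first exact: le_trans (h u hu) xy.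
  exact: bmf_bound (prim_bmf (f_prim k)).
pose c := 2 * n.+2%:R * G + 1.
have c0 : 0 < c by rewrite ltr_wpDl // !mulr_ge0.
have C1 : 0 < C + 1 by rewrite ltr_wpDl.
(* One half of [e] pays for the error of [one_step], the other for the quadratic error of the
   drift. *)
have e1 : 0 < e / (2 * c) by rewrite divr_gt0 // mulr_gt0.
have e2 : 0 < e / (2 * (C + 1)) by rewrite divr_gt0 // mulr_gt0.
have h1 := one_step b_bmf bdZ N a e1.
have h2 : \forall D \near (0 : R)^'+, 0 < D by exact: nbhs_right_gt.
have h3 : \forall D \near (0 : R)^'+, D <= e / (2 * (C + 1)) by exact: nbhs_right_le.
apply: filterS3 h1 h2 h3 => D h1 D0 De t i t0 tD iN Pi.
have ht : 0 <= t <= a by rewrite t0 (le_trans _ tD) // lerDl ltW.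
have hD : 0 <= t + D <= a by rewrite tD addr_ge0 // ltW.
pose g j := if (j < N + n.+1)%N then f (t + D) j else 0.
have g0 j : 0 <= g j by rewrite /g; case: ifP => // _; exact: f_ge0.
have gG j : (j < N + n.+1)%N -> g j <= G.
  move=> jN; rewrite /g jN; apply: le_trans (ler_norm _) _.
  by apply: hG => //; rewrite mem_iota.
have h := h1 t i ht iN Pi (f (t + D)) G (fun j => f_ge0 j hD) G0.
apply: le_trans (h _) _.
  move=> j jN; apply: le_trans (ler_norm _) _.
  by apply: hG => //; rewrite mem_iota.
have := hC t D i t0 (ltW D0) tD iN.
set X := f (t + D) i + _ => hX.
have k1 : 2 * n.+2%:R * G * (e / (2 * c)) * D <= e / 2 * D.
  rewrite (ler_wpM2r (ltW D0)) // mulrA ler_pdivrMr ?mulr_gt0 //.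
  have -> : e / 2 * (2 * c) = c * e by field.
  by rewrite (ler_wpM2r (ltW e0)) // /c lerDl.
have k2 : C * D ^+ 2 <= e / 2 * D.
  rewrite expr2 mulrA (ler_wpM2r (ltW D0)) //.
  apply: (@le_trans _ _ ((C + 1) * D)); first by rewrite (ler_wpM2r (ltW D0)) // lerDl.
  rewrite mulrC -ler_pdivlMr //; apply: le_trans De _.
  by rewrite invfM mulrA.
by move: hX k1 k2; rewrite /X; lra.
Qed.

(** The killed process loses mass when it leaves the states below [N], and [f >= 0] makes this loss
    harmless. Each step costs [e * D] times the mass still present, which is at most 1. *)
Lemma supersolution_grid (N : nat) (e : R) : (1 < N)%N -> 0 < e -> \forall D \near 0^'+,
  forall l, l%:R * D <= a ->
  \sum_(i < N) f (l%:R * D) i *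
     pr P ([set w | Z (l%:R * D) w = i] `&` below Z (grid D l) N) <= f 0 1 + e * (l%:R * D).
Proof.
move=> N1 e0; have h1 := supersolution_step N e0.
have h2 : \forall D \near (0 : R)^'+, 0 < D by exact: nbhs_right_gt.
apply: filterS2 h1 h2 => D h1 D0; elim=> [|l IH] la.
  rewrite mul0r mulr0 addr0.
  have start (i : nat) : pr P ([set w | Z 0 w = i] `&` below Z (grid D 0) N) <= (i == 1%N)%:R.
    have mA : measurable ([set w | Z 0 w = i] `&` below Z (grid D 0) N).
      by apply: measurableI; [exact: (measurable_RV_nat _ [set i]) | exact: measurable_below].
    case: eqP => [_|ni]; first exact: pr_le1.
    rewrite /pr (_ : P _ = 0%E) //; apply: measure_negligible => //.
    apply: negligibleS (bd_start bdZ) => w [/= Zi _] Z1.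
    by apply: ni; rewrite -Zi Z1.
  rewrite (bigD1 (Ordinal N1)) //= big1 ?addr0; last first.
    move=> i; rewrite -val_eqE /= => i1; have := start i; rewrite (negbTE i1) => h.
    have -> : pr P ([set w | Z 0 w = i] `&` below Z [:: 0] N) = 0; last by rewrite mulr0.
    by apply/eqP; rewrite eq_le h pr_ge0.
  rewrite -[leRHS]mulr1 ler_wpM2l ?f_ge0 ?lexx //.
set t := l%:R * D.
have tS : l.+1%:R * D = t + D by rewrite -natr1 mulrDl mul1r.
have t0 : 0 <= t by rewrite mulr_ge0 // ltW.
rewrite tS in la *.
have ta : t <= a by rewrite (le_trans _ la) // lerDl ltW.
have hts v : v \in grid D l -> 0 <= v <= t by apply: gridP; exact: ltW.
have mb := measurable_below Z (grid D l) N.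
have mZ s (i : nat) : measurable [set w | Z s w = i] by exact: (measurable_RV_nat _ [set i]).
(* The head of [grid D l] is the current time, so [below] already forces [Z t w < N] and the sum
   over the current state is finite. *)
have step (j : 'I_N) : pr P ([set w | Z (t + D) w = j] `&` below Z (grid D l.+1) N) =
   \sum_(i < N) pr P ([set w | Z t w = i] `&` below Z (grid D l) N) * transition Z t (t + D) i j.
  have -> : [set w | Z (t + D) w = j] `&` below Z (grid D l.+1) N =
    ([set w | Z (t + D) w = j] `&` below Z (grid D l) N) `&` [set w | (Z t w < N)%N].
    apply/seteqP; split => w /=.
      move=> [Zj hb]; split; first split => //.
        by move=> v vg; apply: hb; rewrite inE vg orbT.
      by apply: hb; rewrite inE; apply/orP; right; rewrite /t; case: (l) => [|l'] /=; rewrite ?mul0r mem_head.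
    move=> [[Zj hb] _]; split => // v; rewrite inE => /predU1P[->|/hb//].
    by rewrite -natr1 mulrDl mul1r Zj.
  rewrite pr_sum_lt; last exact: measurableI.
  apply: eq_bigr => i _.
  have := markov_below (bd_markov bdZ) i j N hts (h := [::]) (fun p => _) t0 (t := t + D).
  have -> : below Z (grid D l) N `&` past Z [::] = below Z (grid D l) N.
    by apply/seteqP; split => w //= [].
  move=> <- //; last by rewrite lerDl ltW.
  by congr pr; rewrite -setIA; congr (_ `&` _); rewrite setIC.
rewrite (eq_bigr (fun j : 'I_N => \sum_(i < N) f (t + D) j *
  (pr P ([set w | Z t w = i] `&` below Z (grid D l) N) * transition Z t (t + D) i j))); last first.
  by move=> j _; rewrite step mulr_sumr.
rewrite exchange_big /=.
pose al i := pr P ([set w | Z t w = i] `&` below Z (grid D l) N).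
have al0 i : 0 <= al i by exact: pr_ge0.
have mal i : measurable ([set w | Z t w = i] `&` below Z (grid D l) N) by exact: measurableI.
apply: (@le_trans _ _ (\sum_(i < N) (f t i * al i + e * D * al i))).
  apply: ler_sum => i _; rewrite -mulrDl.
  have -> : \sum_(j < N) f (t + D) j * (al i * transition Z t (t + D) i j) =
     (\sum_(j < N) f (t + D) j * transition Z t (t + D) i j) * al i.
    by rewrite mulr_suml; apply: eq_bigr => j _; ring.
  (* [supersolution_step] requires a state of positive probability, so zero mass is treated
     apart. *)
  have := al0 i; rewrite le_eqVlt => /predU1P[<-|ali]; first by rewrite !mulr0.
  rewrite ler_pM2r //; apply: h1 => //.
  rewrite pr_gt0 //; apply: lt_le_trans ali _; apply: pr_le => //.
rewrite big_split /= -mulr_sumr.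
have al1 : \sum_(i < N) al i <= 1.
  apply: le_trans (pr_sum_lt1 (Z t) N); apply: ler_sum => i _.
  by apply: pr_le => // w [].
have := IH ta; rewrite -/t => hIH.
have : e * D * \sum_(i < N) al i <= e * D.
  by rewrite -[leRHS]mulr1 ler_wpM2l //; apply: mulr_ge0; exact: ltW.
by move: hIH; rewrite /al; lra.
Qed.

(** Confinement on all grids at once. It is a countable intersection, hence measurable, and implies
    survival of the killed process for every mesh, so the mesh can shrink while the event stays
    fixed. *)
Definition stay (N : nat) : set T :=
  [set w | forall m : nat, below Z (grid (a / m.+1%:R) m.+1) N w].

Lemma measurable_stay N : measurable (stay N).
Proof.
have -> : stay N = \bigcap_m below Z (grid (a / m.+1%:R) m.+1) N.
  by apply/seteqP; split => [w h m _|w h m]; exact: h.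
by apply: bigcapT_measurable => m; exact: measurable_below.
Qed.

Lemma stay_homo M N : (M <= N)%N -> stay M `<=` stay N.
Proof. by move=> MN w h m v vg; apply: leq_trans (h m v vg) MN. Qed.

(* Jump paths are bounded on [0, a], so the decreasing events [~` stay N] have null
   intersection. *)
Lemma leave_small (e : R) : 0 < e -> exists N0, forall N, (N0 <= N)%N -> pr P (~` stay N) <= e.
Proof.
move=> e0.
have mst N : measurable (~` stay N) by apply: measurableC; exact: measurable_stay.
have P0 : P (\bigcap_N ~` stay N) = 0%E.
  apply: measure_negligible; first exact: bigcapT_measurable.
  apply: negligibleS (bd_paths bdZ) => w hw jp.
  have [N hN] := jump_path_bounded jp a_ge0.
  apply: (hw N I) => m v vg; apply: hN.
  have := gridP (_ : 0 <= a / m.+1%:R) vg; rewrite divr_ge0 // => /(_ isT).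
  by rewrite mulrCA mulfV ?mulr1 // pnatr_eq0.
have cv : P \o (fun N => ~` stay N) @ \oo --> 0%E.
  rewrite -P0; apply: nonincreasing_cvg_mu => //.
  - by rewrite (le_lt_trans (probability_le1 P _)) // ?ltry.
  - exact: bigcapT_measurable.
  - by move=> M N MN; apply/subsetPset/subsetC; exact: stay_homo.
have /cvgrPdist_le/(_ e e0) [N0 _ hN0] : (fun N => pr P (~` stay N)) @ \oo --> (0 : R).
  by apply: fine_cvg; exact: cv.
by exists N0 => N /hN0 /=; rewrite sub0r normrN (ger0_norm (pr_ge0 _ _)).
Qed.

(** The mesh is refined first at a fixed level [N] ([key]); then [N] grows by [leave_small]. The
    truncation at [K] gives a statement before integrability is known, and lets one constant [F]
    weigh the paths that leave. *)
Lemma supersolution_expectation (K : nat) :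
  \sum_(i < K) f a i * pr P [set w | Z a w = i] <= f 0 1.
Proof.
have mZ (i : nat) : measurable [set w | Z a w = i] by exact: (measurable_RV_nat _ [set i]).
have mst N : measurable (stay N) by exact: measurable_stay.
have ha : 0 <= a <= a by rewrite a_ge0 lexx.
have key N : (1 < N)%N -> (K <= N)%N ->
    \sum_(i < K) f a i * pr P ([set w | Z a w = i] `&` stay N) <= f 0 1.
  move=> N1 KN; apply/ler_addgt0Pr => e e0.
  apply: (@le_trans _ _ (\sum_(i < N) f a i * pr P ([set w | Z a w = i] `&` stay N))).
    rewrite (big_ord_widen_cond N xpredT (fun i => f a i * pr P ([set w | Z a w = i] `&` stay N))) //=.
    rewrite [leRHS](bigID (fun i : 'I_N => (i < K)%N)) /= lerDl.
    by apply: sumr_ge0 => i _; rewrite mulr_ge0 ?f_ge0 ?pr_ge0.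
  have [m hm] : exists m : nat, \sum_(i < N) f a i *
       pr P ([set w | Z a w = i] `&` below Z (grid (a / m.+1%:R) m.+1) N) <= f 0 1 + e.
    (* For [a = 0] there is nothing to subdivide and [e / a] gives no tolerance; the grid with
       [l = 0] suffices. *)
    have [a0|a0] := ltP 0 a; last first.
      have a00 : a = 0 by apply/eqP; rewrite eq_le a0.
      have e1 : 0 < e / (a + 1) by rewrite a00 add0r divr1.
      have h := supersolution_grid N1 e1.
      have h2 : \forall D \near (0 : R)^'+, 0 < D by exact: nbhs_right_gt.
      have [D [hD D0]] := filter_ex (filterI h h2).
      have := hD 0%N; rewrite mul0r mulr0 addr0 => /(_ a_ge0) h0.
      exists 0%N; apply: (@le_trans _ _ (f 0 1)); last by rewrite lerDl ltW.
      apply: le_trans h0; apply: ler_sum => i _; rewrite a00 ler_wpM2l ?f_ge0 ?lexx ?a_ge0 //.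
      apply: pr_le.
      - by rewrite -{1}a00; apply: measurableI => //; exact: measurable_below.
      - by rewrite -{1}a00; apply: measurableI => //; exact: measurable_below.
      - move=> w [Zi hb]; split => // v; rewrite inE => /eqP ->; apply: hb.
        by rewrite !inE eqxx orbT.
    have e1 : 0 < e / a by rewrite divr_gt0.
    have [D0 /= D00 hD0] := supersolution_grid N1 e1.
    have [m hm] : exists m : nat, a / D0 < m%:R.
      by exists (Num.bound (a / D0)); rewrite archi_boundP // divr_ge0 // ltW.
    exists m.
    have Dgt : 0 < a / m.+1%:R by rewrite divr_gt0.
    have bl : ball_ (fun x : R => `|x|) (0 : R) D0 (a / m.+1%:R).
      rewrite /ball_ /= sub0r normrN gtr0_norm // ltr_pdivrMr // mulrC -ltr_pdivrMr //.
      by apply: lt_trans hm _; rewrite ltr_nat.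
    have E : m.+1%:R * (a / m.+1%:R) = a by rewrite mulrCA mulfV ?mulr1 // pnatr_eq0.
    have h := hD0 _ bl Dgt m.+1.
    rewrite E divfK ?gt_eqF // in h; exact: h.
  apply: le_trans hm; apply: ler_sum => i _; rewrite ler_wpM2l ?f_ge0 //.
  apply: pr_le; [exact: measurableI| |].
    by apply: measurableI => //; exact: measurable_below.
  by move=> w [Zi hs]; split => //; exact: hs.
apply/ler_addgt0Pr => e e0.
pose F := \sum_(i < K) f a i.
have F0 : 0 <= F by apply: sumr_ge0 => i _; exact: f_ge0.
have F1 : 0 < F + 1 by rewrite ltr_wpDl.
have [N0 hN0] := leave_small (divr_gt0 e0 F1).
pose N := maxn N0 (maxn 2 K).
have hN : pr P (~` stay N) <= e / (F + 1) by apply: hN0; rewrite leq_max leqnn.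
have N1 : (1 < N)%N by rewrite /N; lia.
have KN : (K <= N)%N by rewrite /N; lia.
apply: (@le_trans _ _ (\sum_(i < K) f a i * pr P ([set w | Z a w = i] `&` stay N) +
   \sum_(i < K) f a i * (e / (F + 1)))).
  rewrite -big_split /=; apply: ler_sum => i _; rewrite -mulrDr ler_wpM2l ?f_ge0 //.
  apply: (@le_trans _ _ (pr P ([set w | Z a w = i] `&` stay N) + pr P ([set w | Z a w = i] `&` ~` stay N))).
    rewrite -prU; first by rewrite -setIUr setUv setIT.
    - exact: measurableI.
    - by apply: measurableI => //; exact: measurableC.
    - by apply/seteqP; split => // w [[_ h1] [_ h2]].
  rewrite lerD2l; apply: le_trans hN; apply: pr_le => //.
  - by apply: measurableI => //; exact: measurableC.
  - exact: measurableC.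
apply: lerD; first exact: key.
rewrite -mulr_suml -/F mulrC -mulrA ger_pMr // mulrC ler_pdivrMr // mul1r.
by rewrite lerDl.
Qed.

End Supersolution.
End Dynkin.

(** * Bounds for the survival probability *)

Section Extinction.
Context {R : realType}.

(** The quotient [(s^(m+1) - s + m (1 - s)) / (1 - s)^2], written as a polynomial with nonnegative
    coefficients: it has no singularity at [s = 1] and is monotone for [s >= 0]. *)
Definition hsum (m : nat) (s : R) : R := \sum_(j < m) \sum_(l < j.+1) s ^+ l.

Lemma hsum_identity m (s : R) :
  s ^+ m.+1 - s = - m%:R * (1 - s) + (1 - s) ^+ 2 * hsum m s.
Proof.
have gs j : (1 - s) * \sum_(l < j) s ^+ l = 1 - s ^+ j.
  by rewrite -[RHS]opprB subrX1 -mulNr opprB.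
have -> : (1 - s) ^+ 2 * hsum m s = (1 - s) * (m%:R - s * \sum_(j < m) s ^+ j).
  rewrite expr2 -mulrA; congr (_ * _); rewrite /hsum mulr_sumr.
  rewrite (eq_bigr (fun j : 'I_m => 1 - s * s ^+ j)); last first.
    by move=> j _; rewrite gs exprS.
  by rewrite sumrB sumr_const card_ord mulr_sumr.
have := gs m; rewrite exprS => h.
have -> : (1 - s) * (m%:R - s * \sum_(j < m) s ^+ j) =
  (1 - s) * m%:R - s * ((1 - s) * \sum_(j < m) s ^+ j) by ring.
by rewrite h; ring.
Qed.

Lemma le_hsum m (s t : R) : 0 <= s -> s <= t -> hsum m s <= hsum m t.
Proof.
move=> s0 st; do 2 apply: ler_sum => ? _.
by rewrite lerXn2r // nnegrE (le_trans s0).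
Qed.

Lemma hsum0 m : hsum m 0 = m%:R.
Proof.
rewrite /hsum (eq_bigr (fun=> 1)) ?sumr_const ?card_ord // => j _.
rewrite big_ord_recl expr0 big1 ?addr0 // => i _.
by rewrite lift0 expr0n.
Qed.

Lemma hsum1 m : hsum m 1 = (m%:R ^+ 2 + m%:R) / 2.
Proof.
elim: m => [|m IH]; first by rewrite /hsum big_ord0 expr0n addr0 mul0r.
rewrite /hsum big_ord_recr /= -/(hsum m 1) IH.
rewrite (eq_bigr (fun=> 1)) ?sumr_const ?card_ord; last by move=> i _; rewrite expr1n.
by rewrite -natr1; field.
Qed.

Lemma hsum_dist m (s : R) : 0 <= s -> s <= 1 ->
  hsum m 1 - hsum m s <= m%:R ^+ 3 * (1 - s).
Proof.
move=> s0 s1; rewrite /hsum -sumrB.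
have bern l : 1 - s ^+ l <= l%:R * (1 - s).
  rewrite -opprB subrX1 -mulNr opprB mulrC ler_wpM2r ?subr_ge0 //.
  rewrite -[l in l%:R]card_ord -sumr_const; apply: ler_sum => i _.
  by rewrite exprn_ile1.
apply: (@le_trans _ _ (\sum_(j < m) m%:R ^+ 2 * (1 - s))); last first.
  by rewrite sumr_const card_ord -[X in X <= _]mulr_natl mulrA -exprS.
apply: ler_sum => j _; rewrite -sumrB.
apply: (@le_trans _ _ (\sum_(l < j.+1) m%:R * (1 - s))).
  apply: ler_sum => l _; rewrite expr1n; apply: le_trans (bern l) _.
  rewrite ler_wpM2r ?subr_ge0 // ler_nat -ltnS.
  by apply: leq_trans (ltn_ord l) _; rewrite ltnS ltnW.
rewrite sumr_const card_ord expr2 -[X in X <= _]mulr_natl mulrA.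
by rewrite ler_wpM2r ?subr_ge0 // ler_wpM2r // ler_nat.
Qed.

(* s^(k+1) - s = - k (1 - s) + (1 - s)^2 * hjump k s for every jump k >= -1. *)
Definition hjump (k : int) (s : R) : R := if k is Posz m then hsum m s else 0.

Context {d : measure_display} {T : measurableType d}.
Context {P : probability T R} (Z : R -> {RV P >-> nat}).
Variables (n : nat) (b : int -> R -> R) (Cb : R).
Hypothesis b_ge0 : forall k t, k \in jumps n -> 0 <= t -> 0 <= b k t.
Hypothesis b_bmf : forall a k, k \in jumps n -> bmf a (b k).
Hypothesis b_le : forall t, 0 <= t -> total_rate n b t <= Cb.
Hypothesis bdZ : birth_death_process n b Z.

Local Notation m := (jump_moment n b).

(** Defined through the linear equation of the reciprocal mean, because finiteness of the mean is
    not yet known; the case [r = 1] of [moment_exact] identifies the two. *)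
Definition nu (t : R) : R := expR (- itg (m 1) 0 t).

(** The nonlinearity of the backward equation of the generating function: for [q = 1 - s] it reads
    [q' = - m 1 * q + q^2 * gfun (1 - q)]. *)
Definition gfun (s u : R) : R := \sum_(k <- jumps n) b k u * hjump k s.

Lemma moment_bmf a r : bmf a (m r).
Proof. by apply: bmf_sum => k kj; apply: bmfZ; exact: b_bmf. Qed.

Lemma nu_gt0 t : 0 < nu t. Proof. exact: expR_gt0. Qed.

Lemma nu0 : nu 0 = 1.
Proof. by rewrite /nu itgxx oppr0 expR0. Qed.

Lemma nu_prim a : primitive a nu (fun t => nu t * - m 1 t).
Proof.
by apply: (@prim_expR _ a (fun t => - itg (m 1) 0 t)); apply/primN/prim_itg/moment_bmf.
Qed.

Lemma nu_bmf a : bmf a nu. Proof. exact: prim_bmf (nu_prim a). Qed.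

Lemma nu_lower a : exists2 lo, 0 < lo & forall t, 0 <= t <= a -> lo <= nu t.
Proof.
have [C C0 hC] := bmf_bound (prim_bmf (prim_itg (moment_bmf a 1))).
exists (expR (- C)); first exact: expR_gt0.
move=> t /hC; rewrite ler_norml => /andP[_ h].
by rewrite /nu ler_expR lerN2.
Qed.

Lemma hjump_bmf a k s : bmf a s -> bmf a (fun u => hjump k (s u)).
Proof.
move=> bs; case: k => [j|j] /=; last exact: bmf_cst.
by apply: bmf_sum => i _; apply: bmf_sum => l _; exact: bmfX.
Qed.

Lemma gfun_bmf a s : bmf a s -> bmf a (fun u => gfun (s u) u).
Proof.
move=> bs; apply: bmf_sum => k kj; apply: bmfM; first exact: b_bmf.
exact: hjump_bmf.
Qed.

Lemma le_gfun s t u : 0 <= u -> 0 <= s -> s <= t -> gfun s u <= gfun t u.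
Proof.
move=> u0 s0 st; rewrite /gfun !big_seq; apply: ler_sum => k kj.
rewrite ler_wpM2l ?b_ge0 //; case: k {kj} => [j|j] //=; exact: le_hsum.
Qed.

Lemma gfun1 u : gfun 1 u = (m 2 u + m 1 u) / 2.
Proof.
rewrite /gfun /jump_moment -big_split /= mulr_suml !big_seq.
apply: eq_bigr => k /jumpsP[->|[j _ ->]] /=.
  by rewrite mulr0 expr1; ring.
by rewrite hsum1 expr1 -pmulrn; ring.
Qed.

Lemma gfun0 u : gfun 0 u = m 1 u + b (-1) u.
Proof.
rewrite /gfun /jump_moment /jumps !big_cons !big_map.
have -> : \sum_(j <- iota 1 n) b j%:Z u * hjump j%:Z 0 =
   \sum_(j <- iota 1 n) (j%:Z)%:~R ^+ 1 * b j%:Z u.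
  by apply: eq_bigr => j _; rewrite /= hsum0 expr1 mulrC -pmulrn.
by rewrite /= mulr0 expr1; ring.
Qed.

Lemma birth_le_gfun0 u : 0 <= u -> birth_rate n b u <= gfun 0 u.
Proof.
move=> u0; rewrite /birth_rate /gfun /jumps big_cons /= mulr0 add0r big_map.
rewrite /index_iota subSS subn0 !big_seq; apply: ler_sum => j.
rewrite mem_iota add1n ltnS => /andP[j1 jn]; rewrite /= hsum0.
apply: ler_peMr; last by rewrite ler1n.
apply: b_ge0 => //; rewrite inE; apply/orP; right; apply/mapP; exists j => //.
by rewrite mem_iota add1n ltnS j1.
Qed.

Lemma gfun_dist s u : 0 <= u -> 0 <= s -> s <= 1 ->
  gfun 1 u - gfun s u <= n%:R ^+ 3 * Cb * (1 - s).
Proof.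
move=> u0 s0 s1; rewrite /gfun -sumrB.
apply: (@le_trans _ _ (\sum_(k <- jumps n) b k u * (n%:R ^+ 3 * (1 - s)))).
  rewrite !big_seq; apply: ler_sum => k kj; rewrite -mulrBr ler_wpM2l ?b_ge0 //.
  case: (jumpsP kj) => [->|[j /andP[_ jn] ->]] /=.
    by rewrite subrr mulr_ge0 ?subr_ge0 // exprn_ge0.
  apply: le_trans (hsum_dist _ s0 s1) _.
  by rewrite ler_wpM2r ?subr_ge0 // lerXn2r ?nnegrE // ler_nat.
rewrite -mulr_suml -total_rateE mulrCA -mulrA ler_wpM2l ?exprn_ge0 //.
by rewrite ler_wpM2r ?subr_ge0 // b_le.
Qed.

(** This is the branching property: the factor [i * s^(i-1)] splits off, so the sign of one scalar
    expression in [s] decides for all states at once. *)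
Lemma generator_pow s u i : generator n b (fun i => s ^+ i) u i =
  i%:R * s ^+ i.-1 * (- ((1 - s) * m 1 u) + (1 - s) ^+ 2 * gfun s u).
Proof.
rewrite /generator; case: i => [|i]; first by rewrite !mul0r.
rewrite -mulrA; congr (_ * _).
have -> : - ((1 - s) * m 1 u) + (1 - s) ^+ 2 * gfun s u =
   \sum_(k <- jumps n) b k u * (- k%:~R * (1 - s) + (1 - s) ^+ 2 * hjump k s).
  rewrite /jump_moment /gfun !mulr_sumr -sumrN -big_split /=.
  by apply: eq_bigr => k _; rewrite expr1; ring.
rewrite mulr_sumr !big_seq; apply: eq_bigr => k kj.
rewrite mulrCA; congr (_ * _); rewrite succnK.
case: (jumpsP kj) => [->|[j _ ->]].
  have -> : target i.+1 (-1) = i by rewrite /target; lia.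
  by rewrite /= exprS mulr0 addr0; ring.
have -> : target i.+1 j = (i + j.+1)%N by rewrite /target; lia.
by rewrite /= -pmulrn -hsum_identity exprD mulrBr -exprSr.
Qed.

Section Bounds.
Variables (a : R) (w r : R -> R).
Hypothesis a_ge0 : 0 <= a.
Hypothesis w_prim : primitive a w (fun t => - (nu t * r t)).
Hypothesis w_ge : forall t, 0 <= t <= a -> nu t <= w t.

Let s t := 1 - nu t / w t.

Lemma w_gt0 t : 0 <= t <= a -> 0 < w t.
Proof. by move=> /w_ge; apply: lt_le_trans; exact: nu_gt0. Qed.

Lemma slope_ge0 t : 0 <= t <= a -> 0 <= s t.
Proof. by move=> ht; rewrite /s subr_ge0 ler_pdivrMr ?w_gt0 // mul1r w_ge. Qed.

Lemma slope_le1 t : 0 <= t <= a -> s t <= 1.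
Proof.
by move=> ht; rewrite /s gerBl divr_ge0 ?(ltW (nu_gt0 _)) // ltW // w_gt0.
Qed.

(** The substitution [w = nu / (1 - s)] turns the Riccati equation [s' = (1 - s) m 1 - (1 - s)^2 r]
    into the plain integration [w' = - nu r]. *)
Lemma slope_prim : primitive a s (fun t => (1 - s t) * m 1 t - (1 - s t) ^+ 2 * r t).
Proof.
have [lo lo0 hlo] := nu_lower a.
have hw t : 0 <= t <= a -> lo <= w t.
  by move=> ht; apply: le_trans (hlo t ht) (w_ge ht).
have := primD (prim_cst a 1) (primN (primM (nu_prim a) (prim_inv lo0 hw w_prim))).
apply: prim_eq => t ht //.
have w0 := lt0r_neq0 (w_gt0 ht).
by rewrite /s; field.
Qed.

Lemma pow_prim i : primitive a (fun t => s t ^+ i)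
  (fun t => i%:R * s t ^+ i.-1 * ((1 - s t) * m 1 t - (1 - s t) ^+ 2 * r t)).
Proof. exact: primX slope_prim. Qed.

Lemma extinct_le : (forall t, 0 <= t <= a -> gfun (s t) t <= r t) ->
  pr P [set w | Z a w = 0%N] <= s 0.
Proof.
move=> hr.
have := @supersolution_expectation _ _ _ _ Z n b b_bmf bdZ a (fun t i => s t ^+ i)
  (fun t i => i%:R * s t ^+ i.-1 * ((1 - s t) * m 1 t - (1 - s t) ^+ 2 * r t)) a_ge0.
(* Only state 0 is read off: [s a ^+ 0 = 1] whatever the terminal value [s a]. *)
move=> /(_ _ pow_prim _ 1%N); rewrite big_ord1 expr0 mul1r expr1; apply.
- by move=> u i hu; rewrite exprn_ge0 // slope_ge0.
- move=> u i hu; rewrite generator_pow -mulrDr.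
  have -> : (1 - s u) * m 1 u - (1 - s u) ^+ 2 * r u +
     (- ((1 - s u) * m 1 u) + (1 - s u) ^+ 2 * gfun (s u) u) =
     (1 - s u) ^+ 2 * (gfun (s u) u - r u) by ring.
  rewrite mulr_ge0_le0 ?mulr_ge0 ?exprn_ge0 ?slope_ge0 // mulr_ge0_le0 ?sqr_ge0 //.
  by rewrite subr_le0 hr.
Qed.

Lemma survive_le K : (forall t, 0 <= t <= a -> r t <= gfun (s t) t) -> w a = nu a ->
  \sum_(i < K) (val i != 0%N)%:R * pr P [set w | Z a w = i] <= 1 - s 0.
Proof.
move=> hr wa.
(* With terminal value [s a = 0], the function [1 - s a ^+ i] is the indicator of survival. *)
have sa : s a = 0 by rewrite /s wa divff ?subrr // gt_eqF // nu_gt0.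
have := @supersolution_expectation _ _ _ _ Z n b b_bmf bdZ a (fun t i => 1 - s t ^+ i)
  (fun t i => 0 - i%:R * s t ^+ i.-1 * ((1 - s t) * m 1 t - (1 - s t) ^+ 2 * r t)) a_ge0.
move=> /(_ _ (fun i => primD (prim_cst a 1) (primN (pow_prim i))) _ K) h.
rewrite (eq_bigr (fun i : 'I_K => (1 - s a ^+ i) * pr P [set w | Z a w = i])); last first.
  by move=> i _; rewrite sa expr0n; case: eqP => _; rewrite ?subrr ?subr0.
rewrite -[s 0]expr1; apply: h.
- by move=> u i hu; rewrite subr_ge0 exprn_ile1 ?slope_ge0 ?slope_le1.
- move=> u i hu.
  have -> : generator n b (fun i => 1 - s u ^+ i) u i = - generator n b (fun i => s u ^+ i) u i.
    rewrite /generator -mulrN -sumrN; congr (_ * _); apply: eq_bigr => k _; ring.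
  rewrite generator_pow sub0r -opprD -mulrDr oppr_le0.
  have -> : (1 - s u) * m 1 u - (1 - s u) ^+ 2 * r u +
     (- ((1 - s u) * m 1 u) + (1 - s u) ^+ 2 * gfun (s u) u) =
     (1 - s u) ^+ 2 * (gfun (s u) u - r u) by ring.
  apply: mulr_ge0; first by rewrite mulr_ge0 ?exprn_ge0 ?slope_ge0.
  by apply: mulr_ge0; [exact: sqr_ge0 | rewrite subr_ge0 hr].
Qed.

End Bounds.

Definition Gam (a : R) : R := itg (fun u => m 2 u * nu u / 2) 0 a.

Lemma tail_prim a r : bmf a r ->
  primitive a (fun t => nu a + itg (fun u => nu u * r u) t a) (fun t => - (nu t * r t)).
Proof.
move=> br; have bnr : bmf a (fun u => nu u * r u) by apply: bmfM => //; exact: nu_bmf.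
have := primD (prim_cst a (nu a)) (prim_itg_tail bnr).
by apply: prim_eq => t _ //; rewrite add0r.
Qed.

(** [nu t] equals [nu a] plus the integral of [nu * m 1] over [[t, a]], and [gfun 0 = m 1 + b (-1)]
    dominates [m 1]. This keeps the slope [1 - nu / w] nonnegative. *)
Lemma tail_ge a r : bmf a r -> (forall t, 0 <= t <= a -> gfun 0 t <= r t) ->
  forall t, 0 <= t <= a -> nu t <= nu a + itg (fun u => nu u * r u) t a.
Proof.
move=> br hr t /andP[t0 ta].
have [_ /(_ t a t0 ta (lexx _)) h] := nu_prim a.
rewrite -lerBlDl -opprB h -(@itgN _ a) //; last exact: (nu_prim a).1.
apply: (@le_itg _ a) => //.
- exact: bmfN (nu_prim a).1.
- by apply: bmfM => //; exact: nu_bmf.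
- move=> u /andP[tu ua]; have hu : 0 <= u <= a by rewrite ua (le_trans t0).
  rewrite -mulrN opprK ler_wpM2l ?(ltW (nu_gt0 _)) //; apply: le_trans (hr u hu).
  by rewrite gfun0 lerDl; apply: b_ge0; [rewrite inE eqxx | case/andP: hu].
Qed.

Lemma gfun_ge_gfun0 u (s : R) : 0 <= u -> 0 <= s -> gfun 0 u <= gfun s u.
Proof. by move=> u0 s0; exact: le_gfun. Qed.

(** In [gfun 1 = (m 2 + m 1) / 2] the first half integrates to [Gam], while [nu * m 1] is minus the
    derivative of [nu] and leaves only boundary terms. *)
Lemma itg_gfun1 a : 0 <= a -> nu a + itg (fun u => nu u * gfun 1 u) 0 a = Gam a + (1 + nu a) / 2.
Proof.
move=> a0.
have bn := nu_bmf a; have b2 := moment_bmf a 2; have b1 := moment_bmf a 1.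
have [bn' /(_ 0 a (lexx _) a0 (lexx _)) h] := nu_prim a.
have -> : itg (fun u => nu u * gfun 1 u) 0 a =
   itg (fun u => m 2 u * nu u / 2 + (- 2^-1) * (nu u * - m 1 u)) 0 a.
  by apply: eq_itg => u _; rewrite gfun1; field.
rewrite (@itgD _ a) //; last exact: bmfZ.
  by rewrite (@itgZ _ a) // -h nu0 /Gam; field.
by apply: bmfM; [exact: bmfM | exact: bmf_cst].
Qed.

(** Taking for [r] the largest value [gfun 1] of [gfun] over slopes in [[0, 1]] makes [w] an
    explicit integral. *)
Lemma survival_lower a : 0 <= a ->
  1 <= (1 - pr P [set w | Z a w = 0%N]) * (Gam a + (1 + nu a) / 2).
Proof.
move=> a0.
have b1 : bmf a (gfun 1) by apply: (@gfun_bmf a (fun=> 1)); exact: bmf_cst.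
have hge := tail_ge b1 (fun t ht => gfun_ge_gfun0 (andP ht).1 ler01).
have h := extinct_le a0 (tail_prim b1) hge.
rewrite -itg_gfun1 //; set W := nu a + _.
have h0 : (0 : R) <= 0 <= a by rewrite a0 lexx.
have W0 : 0 < W by apply: lt_le_trans (nu_gt0 0) _; exact: hge.
rewrite -ler_pdivrMr // mul1r lerBrDr -lerBrDl.
move: h; rewrite -/W nu0 mul1r => h; apply: h => t ht.
apply: le_gfun; [by case/andP: ht | exact: (slope_ge0 hge) | exact: (slope_le1 hge)].
Qed.

(* A first supersolution of the Riccati equation; its defect, integrated against
   nu, is the error of the second one. *)
Definition q1 (a t : R) : R := nu t / (nu a + itg (fun u => nu u * gfun 0 u) t a).

(** A monotone Picard step: replacing [gfun 0] by [gfun (1 - q1)] increases [w], so [nu / w] falls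
    below [q1], the new slope is at least [1 - q1], and [r <= gfun] holds along it. [gfun_dist]
    measures the loss against [gfun 1]. *)
Lemma survival_upper a K : 0 <= a ->
  (\sum_(i < K) (val i != 0%N)%:R * pr P [set w | Z a w = i]) *
  (Gam a + (1 + nu a) / 2 - n%:R ^+ 3 * Cb * itg (fun u => nu u * q1 a u) 0 a) <= 1.
Proof.
move=> a0.
have b0 : bmf a (gfun 0) by apply: (@gfun_bmf a (fun=> 0)); exact: bmf_cst.
have b1 : bmf a (gfun 1) by apply: (@gfun_bmf a (fun=> 1)); exact: bmf_cst.
have hge1 := tail_ge b0 (fun t ht => lexx _).
have sp := slope_prim (tail_prim b0) hge1.
pose s1 t := 1 - q1 a t.
have bs1 : bmf a s1 by exact: prim_bmf sp.
pose r t := gfun (s1 t) t.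
have br : bmf a r by exact: gfun_bmf.
have s1_ge0 t : 0 <= t <= a -> 0 <= s1 t by exact: (slope_ge0 hge1).
have s1_le1 t : 0 <= t <= a -> s1 t <= 1 by exact: (slope_le1 hge1).
have hr t : 0 <= t <= a -> gfun 0 t <= r t.
  by move=> ht; apply: gfun_ge_gfun0; [case/andP: ht | exact: s1_ge0].
have hge := tail_ge br hr.
have bn := nu_bmf a.
have w12 t : 0 <= t <= a -> itg (fun u => nu u * gfun 0 u) t a <= itg (fun u => nu u * r u) t a.
  move=> /andP[t0 ta]; apply: (@le_itg _ a) => //; [exact: bmfM|exact: bmfM|].
  move=> u /andP[tu ua]; rewrite ler_wpM2l ?(ltW (nu_gt0 _)) // hr //.
  by rewrite (le_trans t0).
have h := survive_le a0 (tail_prim br) hge K.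
set W := nu a + itg (fun u => nu u * r u) 0 a in h *.
have h0 : (0 : R) <= 0 <= a by rewrite a0 lexx.
have W0 : 0 < W by apply: lt_le_trans (nu_gt0 0) _; exact: hge.
set S := \sum_(i < K) _ in h *.
have S0 : 0 <= S by apply: sumr_ge0 => i _; rewrite mulr_ge0 ?pr_ge0.
have SW : S * W <= 1.
  rewrite -ler_pdivlMr //; move: h; rewrite nu0 subKr; apply; last first.
    by rewrite itgxx addr0.
  move=> t ht; apply: le_gfun; [by case/andP: ht | exact: s1_ge0 |].
  rewrite /s1 lerD2l lerN2 /q1 ler_wpM2l ?(ltW (nu_gt0 _)) // lef_pV2 ?posrE.
  - by rewrite lerD2l w12.
  - by apply: lt_le_trans (nu_gt0 t) _; exact: hge.
  - by apply: lt_le_trans (nu_gt0 t) _; exact: hge1.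
apply: le_trans SW; rewrite ler_wpM2l //.
rewrite -itg_gfun1 // /W -addrA lerD2l lerBlDl -lerBlDr.
have bq : bmf a (q1 a).
  have -> : q1 a = (fun t => 1 - s1 t) by apply/funext => t; rewrite /s1 subKr.
  by apply: bmfB => //; exact: bmf_cst.
rewrite -(@itgB _ a) //; [|exact: bmfM..].
rewrite -(@itgZ _ a) //; last exact: bmfM.
apply: (@le_itg _ a) => //.
- by apply: bmfB; exact: bmfM.
- by apply: bmfZ; exact: bmfM.
move=> u hu; rewrite -mulrBr mulrCA ler_wpM2l ?(ltW (nu_gt0 _)) //.
have -> : q1 a u = 1 - s1 u by rewrite /s1 subKr.
by apply: gfun_dist; [case/andP: hu | exact: s1_ge0 | exact: s1_le1].
Qed.

End Extinction.

(** * Exact moments *)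

Section Moments.
Context {R : realType} {d : measure_display} {T : measurableType d}.
Context {P : probability T R} (Z : R -> {RV P >-> nat}).
Variables (n : nat) (b : int -> R -> R).
Hypothesis b_bmf : forall a k, k \in jumps n -> bmf a (b k).
Hypothesis bdZ : birth_death_process n b Z.

Local Notation m := (jump_moment n b).
Local Notation nu := (nu n b).

Lemma pr_sum_cvg1 (X : {RV P >-> nat}) :
  (fun K => \sum_(i < K) pr P [set w | X w = i]) @ \oo --> (1 : R).
Proof.
have mlt (N : nat) : measurable [set w | (X w < N)%N].
  exact: (measurable_RV_nat X [set i | (i < N)%N]).
have -> : (fun K => \sum_(i < K) pr P [set w | X w = i]) =
    (fun K => pr P [set w | (X w < K)%N]).
  apply/funext => K; have := pr_sum_lt X K (@measurableT _ T); rewrite setTI => ->.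
  by apply: eq_bigr => i _; rewrite setTI.
apply: fine_cvg.
have U : \bigcup_N [set w | (X w < N)%N] = setT.
  by apply/seteqP; split => // w _; exists (X w).+1 => //=.
rewrite -(@probability_setT _ _ _ P) -U; apply: nondecreasing_cvg_mu => //.
- by rewrite U.
- by move=> M N MN; apply/subsetPset => w /= h; exact: leq_trans MN.
Qed.

(** The intensity factor [i] restores the degree that the difference loses, so no higher power
    appears and the hierarchy of moments closes. *)
Lemma generator_monomial u i j : (0 < j)%N ->
  generator n b (fun i => i%:R ^+ j) u i =
  \sum_(l < j) 'C(j, l.+1)%:R * m l.+1 u * i%:R ^+ (j - l).
Proof.
move=> j0; rewrite /generator; case: i => [|i].
  rewrite mul0r big1 // => l _; rewrite expr0n.
  by rewrite (_ : (j - l == 0)%N = false) ?mulr0 // -(negbTE (_ : j - l != 0)%N) // -lt0n subn_gt0.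
rewrite /jump_moment mulr_sumr.
rewrite [RHS](eq_bigr (fun l : 'I_j => \sum_(k <- jumps n)
   'C(j, l.+1)%:R * (k%:~R ^+ l.+1 * b k u) * i.+1%:R ^+ (j - l))); last first.
  by move=> l _; rewrite mulr_sumr mulr_suml.
rewrite exchange_big /= !big_seq; apply: eq_bigr => k kj.
have -> : (target i.+1 k)%:R = i.+1%:R + k%:~R :> R.
  by rewrite !pmulrn (targetE kj) // intrD.
rewrite exprDn big_ord_recl subn0 expr0 mulr1 bin0 mulr1n addrC addKr.
rewrite !mulr_sumr; apply: eq_bigr => l _.
rewrite lift0 -[_ *+ 'C(_, _)]mulr_natl.
have -> : (j - l = (j - l.+1).+1)%N by have := ltn_ord l; lia.
by rewrite (exprS i.+1%:R); ring.
Qed.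

(** Regroups the double sum by the total drop [k + l.+1] of the degree, so that equal powers of [i]
    meet in [mart_gen]. *)
Lemma sum_antidiagonals (F : nat -> nat -> R) r :
  \sum_(k < r) \sum_(l < r - k.+1) F k l.+1 = \sum_(k < r) \sum_(l < k) F (k - l.+1)%N l.+1.
Proof.
elim: r => [|r IH]; first by rewrite !big_ord0.
rewrite [RHS]big_ord_recr /= -IH big_ord_recr /= subnn big_ord0 addr0.
rewrite (eq_bigr (fun k : 'I_r => \sum_(l < r - k.+1) F k l.+1 + F k (r - k)%N)); last first.
  move=> k _; have -> : (r.+1 - k.+1 = (r - k.+1).+1)%N by have := ltn_ord k; lia.
  by rewrite big_ord_recr /=; congr (_ + F _ _); have := ltn_ord k; lia.
rewrite big_split /=; congr (_ + _).
rewrite (reindex_inj rev_ord_inj) /=; apply: eq_bigr => l _.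
by congr (F _ _); have := ltn_ord l; lia.
Qed.

Section Coefficients.
Variables (a : R) (r : nat).

(* The coefficient of (i nu)^(j-l) in the generator applied to (i nu)^j. *)
Definition rate_coef (j l : nat) (u : R) : R := 'C(j, l.+1)%:R * m l.+1 u * nu u ^+ l.

(* coefs k lists coef k, ..., coef 0, where coef k multiplies (i nu)^(r-k) in mart;
   storing all of them makes this strong recursion structural. *)
Fixpoint coefs (k : nat) : seq (R -> R) :=
  if k is k'.+1 then
    (fun t => itg (fun u => \sum_(l < k'.+1)
       nth (fun=> 0) (coefs k') l u * rate_coef (r - (k' - l)) l.+1 u) t a) :: coefs k'
  else [:: fun=> 1].

Definition coef (k : nat) : R -> R := nth (fun=> 0) (coefs k) 0.

(** Minus the derivative of [coef k]: all that the generator sends from the powers above [r - k]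
    down to [r - k]. *)
Definition dcoef (k : nat) (u : R) : R :=
  \sum_(l < k) coef (k - l.+1) u * rate_coef (r - (k - l.+1)) l.+1 u.

Lemma nth_coefs k l : (l <= k)%N -> nth (fun=> 0) (coefs k) l = coef (k - l).
Proof.
elim: k l => [|k IH] [|l] // lk.
by rewrite [LHS]/= subSS IH.
Qed.

Lemma coef_0 u : coef 0 u = 1. Proof. by []. Qed.

Lemma coef_itg k t : (0 < k)%N -> coef k t = itg (dcoef k) t a.
Proof.
case: k => // k _; rewrite {1}/coef /=; congr (itg _ _ _); apply/funext => u.
by apply: eq_bigr => l _; rewrite nth_coefs ?subSS // -ltnS.
Qed.

Lemma rate_coef_bmf j l : bmf a (rate_coef j l).
Proof.
apply: bmfM; first by apply: bmfZ; exact: moment_bmf.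
by apply: bmfX; exact: nu_bmf.
Qed.

Lemma dcoef_bmf_of k : (forall l, (l < k)%N -> bmf a (coef l)) -> bmf a (dcoef k).
Proof.
move=> h; apply: bmf_sum => l _; apply: bmfM; last exact: rate_coef_bmf.
by apply: h; have := ltn_ord l; lia.
Qed.

Lemma coef_prim k : primitive a (coef k) (fun u => - dcoef k u).
Proof.
elim/ltn_ind: k => -[|k] IH.
  apply: prim_eq (prim_cst a 1) => t _ //.
  by rewrite /dcoef big_ord0 oppr0.
have hd : bmf a (dcoef k.+1) by apply: dcoef_bmf_of => l /IH /prim_bmf.
by apply: prim_eq (prim_itg_tail hd) => t _ //; rewrite coef_itg.
Qed.

Lemma coef_bmf k : bmf a (coef k). Proof. exact: prim_bmf (coef_prim k). Qed.

Lemma dcoef_bmf k : bmf a (dcoef k).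
Proof. by apply: dcoef_bmf_of => l _; exact: coef_bmf. Qed.

(** A backward solution whose terminal value at [a] is [(i * nu a) ^+ r], because every [coef k]
    with [k > 0] vanishes there. No constant term occurs: the generator never lowers the degree to
    0. *)
Definition mart (t : R) (i : nat) : R := \sum_(k < r) coef k t * (i%:R * nu t) ^+ (r - k).

Definition dmart (t : R) (i : nat) : R :=
  \sum_(k < r) (- dcoef k t * (i%:R * nu t) ^+ (r - k) -
    coef k t * ((r - k)%:R * m 1 t * (i%:R * nu t) ^+ (r - k))).

Lemma mart_prim i : primitive a (mart ^~ i) (dmart ^~ i).
Proof.
apply: prim_sum => k _.
have := primM (coef_prim k) (primX (r - k) (primZ i%:R (nu_prim b_bmf a))).
apply: prim_eq => t _ //; congr (_ + _).
have kr := ltn_ord k; have -> : (r - k = (r - k).-1.+1)%N by lia.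
by rewrite [in RHS]exprS /=; ring.
Qed.

Lemma generatorD f g u i : generator n b (fun i => f i + g i) u i =
  generator n b f u i + generator n b g u i.
Proof.
rewrite /generator -mulrDr -big_split /=; congr (_ * _); apply: eq_bigr => k _; ring.
Qed.

Lemma generatorZ c f u i : generator n b (fun i => c * f i) u i = c * generator n b f u i.
Proof.
rewrite /generator mulrCA; congr (_ * _); rewrite mulr_sumr; apply: eq_bigr => k _; ring.
Qed.

Lemma generator_cst c u i : generator n b (fun=> c) u i = 0.
Proof. by rewrite /generator big1 ?mulr0 // => k _; rewrite subrr mulr0. Qed.

Lemma generator_sum (I : Type) (s : seq I) (F : I -> nat -> R) u i :
  generator n b (fun i => \sum_(k <- s) F k i) u i = \sum_(k <- s) generator n b (F k) u i.
Proof.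
elim: s => [|k s IH].
  have -> : (fun i => \sum_(k <- [::]) F k i) = (fun=> 0).
    by apply/funext => j; rewrite big_nil.
  by rewrite generator_cst big_nil.
have -> : (fun i => \sum_(k <- k :: s) F k i) = (fun i => F k i + \sum_(k <- s) F k i).
  by apply/funext => j; rewrite big_cons.
by rewrite generatorD IH big_cons.
Qed.

(** The part of the generator that keeps the degree is the mean drift, cancelled by the decay of the
    powers of [nu]; the parts that lower it are cancelled by [dcoef]. *)
Lemma mart_gen u i : dmart u i + generator n b (mart u) u i = 0.
Proof.
rewrite /mart generator_sum /dmart -big_split /=.
have E (k : 'I_r) : generator n b (fun i => coef k u * (i%:R * nu u) ^+ (r - k)) u i =
   coef k u * ((r - k)%:R * m 1 u * (i%:R * nu u) ^+ (r - k)) +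
   \sum_(l < r - k.+1) coef k u * rate_coef (r - k) l.+1 u * (i%:R * nu u) ^+ (r - (k + l.+1)).
  have kr := ltn_ord k.
  have -> : (fun i => coef k u * (i%:R * nu u) ^+ (r - k)) =
     (fun i : nat => (coef k u * nu u ^+ (r - k)) * i%:R ^+ (r - k)).
    by apply/funext => j; rewrite exprMn; ring.
  rewrite generatorZ generator_monomial ?subn_gt0 //.
  have -> : (r - k = (r - k.+1).+1)%N by lia.
  rewrite big_ord_recl mulrDr subn0 bin1; congr (_ + _); first by rewrite exprMn; ring.
  rewrite mulr_sumr; apply: eq_bigr => l _.
  rewrite lift0 /rate_coef.
  have lr := ltn_ord l.
  have E1 : (r - (k + l.+1) = (r - k.+1) - l)%N by lia.
  have E2 : ((r - k.+1).+1 = ((r - k.+1) - l) + l.+1)%N by lia.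
  rewrite E1 subSS {1}E2 exprD exprMn; ring.
rewrite (eq_bigr (fun k : 'I_r => - dcoef k u * (i%:R * nu u) ^+ (r - k) +
   \sum_(l < r - k.+1) coef k u * rate_coef (r - k) l.+1 u * (i%:R * nu u) ^+ (r - (k + l.+1)))); last first.
  by move=> k _; rewrite E; ring.
rewrite big_split /= (sum_antidiagonals (fun k l =>
   coef k u * rate_coef (r - k) l u * (i%:R * nu u) ^+ (r - (k + l)))) -big_split /=.
apply: big1 => k _; rewrite /dcoef mulNr mulr_suml -sumrN -big_split /=.
apply: big1 => l _; have lk := ltn_ord l.
have -> : (k - l.+1 + l.+1 = k)%N by lia.
by rewrite addNr.
Qed.

End Coefficients.

Lemma expr_nat_le (i j l : nat) : (0 < j)%N -> (j <= l)%N -> (i%:R : R) ^+ j <= i%:R ^+ l.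
Proof.
case: i => [|i] j0 jl; first by rewrite !expr0n !gtn_eqF // (leq_trans j0).
by rewrite ler_weXn2l // ler1n.
Qed.

(** On the integers [i ^+ j] dominates all lower positive powers. Consequently
    [expR (- La * t) * i ^+ j] is a supersolution, whence finite moments. *)
Lemma power_supersolution a j : (0 < j)%N -> exists2 La : R, 0 <= La &
  forall u i, 0 <= u <= a -> generator n b (fun i => i%:R ^+ j) u i <= La * i%:R ^+ j.
Proof.
move=> j0.
have [B B0 hB] : exists2 B : R, 0 <= B & forall l, l \in iota 0 j ->
    forall u, 0 <= u <= a -> `|m l.+1 u| <= B.
  apply: common_bound => [k x y xy h u hu|k _]; first exact: le_trans (h u hu) xy.
  exact: bmf_bound (moment_bmf b_bmf a _).
exists (\sum_(l < j) 'C(j, l.+1)%:R * B).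
  by apply: sumr_ge0 => l _; rewrite mulr_ge0.
move=> u i hu; rewrite generator_monomial // mulr_suml; apply: ler_sum => l _.
rewrite -!mulrA ler_wpM2l //.
have hm : m l.+1 u <= B.
  by apply: le_trans (ler_norm _) _; apply: hB => //; rewrite mem_iota /=.
apply: (@le_trans _ _ (B * i%:R ^+ (j - l))).
  by rewrite ler_wpM2r // exprn_ge0.
rewrite ler_wpM2l // expr_nat_le ?leq_subr // subn_gt0 //.
Qed.

Lemma prim_expdecay (a La : R) : primitive a (fun t => expR (- La * t)) (fun t => expR (- La * t) * - La).
Proof.
apply: (@prim_expR _ a (fun t => - La * t)); split; first exact: bmf_cst.
by move=> s t s0 st ta; rewrite itg_cst // mulrBr.
Qed.

Lemma moment_bounded a j : 0 <= a -> (0 < j)%N -> exists C : R, forall K,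
  \sum_(i < K) i%:R ^+ j * pr P [set w | Z a w = i] <= C.
Proof.
move=> a0 j0; have [La La0 hLa] := power_supersolution a j0.
exists (expR (La * a)) => K.
have := @supersolution_expectation _ _ _ _ Z n b b_bmf bdZ a
  (fun t i => expR (- La * t) * i%:R ^+ j) (fun t i => i%:R ^+ j * (expR (- La * t) * - La)) a0.
move=> /(_ _ _ _ K) h.
have {h} : \sum_(i < K) expR (- La * a) * i%:R ^+ j * pr P [set w | Z a w = i] <= 1.
  rewrite -[leRHS](_ : expR (- La * 0) * 1%:R ^+ j = 1); last first.
    by rewrite mulr0 expR0 expr1n mulr1.
  apply: h.
  - by move=> u i _; rewrite mulr_ge0 ?expR_ge0 ?exprn_ge0.
  - by move=> i; apply: prim_eq (primZ (i%:R ^+ j) (prim_expdecay a La)) => t _ //; rewrite mulrC.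
  - move=> u i hu; rewrite generatorZ; have := hLa u i hu.
    have := expR_ge0 (- La * u); set x := expR _ => x0 hl.
    by have := ler_wpM2l x0 hl; lra.
rewrite (eq_bigr (fun i : 'I_K => expR (- La * a) * (i%:R ^+ j * pr P [set w | Z a w = i]))); last first.
  by move=> i _; rewrite mulrA.
rewrite -mulr_sumr => h.
have e1 : expR (La * a) * expR (- La * a) = 1 by rewrite mulNr expRxMexpNx_1.
by have := ler_wpM2l (expR_ge0 (La * a)) h; rewrite mulrA e1 mul1r mulr1.
Qed.

(** Test functions must be nonnegative, while neither [mart] nor its opposite need be. Adding
    [eps * h], of one degree more, and a constant [D] restores the sign; the choices [sg = 1] and
    [sg = -1], with [eps] tending to 0, give equality. *)
Lemma moment_exact a r : 0 <= a -> (0 < r)%N ->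
  (fun K => \sum_(i < K) i%:R ^+ r * pr P [set w | Z a w = i]) @ \oo -->
  nu a ^- r * \sum_(k < r) coef a r k 0.
Proof.
move=> a0 r0.
set S := fun K => _.
have [C hC] := moment_bounded a0 r0.
have ndS : nondecreasing_seq S.
  apply/nondecreasing_seqP => K; rewrite /S big_ord_recr /= lerDl.
  by rewrite mulr_ge0 ?pr_ge0 // exprn_ge0.
have cS : cvgn S.
  by apply: nondecreasing_is_cvgn => //; exists C => _ [K _ <-]; exact: hC.
suff -> : nu a ^- r * \sum_(k < r) coef a r k 0 = limn S by exact: cS.
set e := \sum_(k < r) coef a r k 0.
have nu0' : nu a ^+ r != 0 by rewrite expf_neq0 // gt_eqF // nu_gt0.
have key (sg : R) : `|sg| = 1 -> forall eps, 0 < eps ->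
    sg * (nu a ^+ r * limn S) <= eps + sg * e.
  move=> sg1 eps eps0.
  have r1 : (0 < r.+1)%N by [].
  have [La La0 hLa] := power_supersolution a r1.
  have [B B0 hB] : exists2 B : R, 0 <= B & forall t i, 0 <= t <= a ->
      `|mart a r t i| <= B * i%:R ^+ r.
    have [B B0 hB] : exists2 B : R, 0 <= B & forall k, k \in iota 0 r ->
        forall t, 0 <= t <= a -> `|coef a r k t * nu t ^+ (r - k)| <= B.
      apply: common_bound => [k x y xy h u hu|k _]; first exact: le_trans (h u hu) xy.
      apply: bmf_bound; apply: bmfM; first exact: coef_bmf.
      by apply: bmfX; exact: nu_bmf.
    exists (r%:R * B); first exact: mulr_ge0.
    move=> t i ht; rewrite /mart; apply: le_trans (ler_norm_sum _ _ _) _.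
    apply: (@le_trans _ _ (\sum_(k < r) B * i%:R ^+ r)); last first.
      by rewrite sumr_const card_ord -mulrA mulr_natl.
    apply: ler_sum => k _; rewrite exprMn mulrCA normrM mulrC.
    apply: ler_pM => //; first by apply: hB => //; rewrite mem_iota /=.
    rewrite ger0_norm ?exprn_ge0 // expr_nat_le ?leq_subr // subn_gt0 //.
  pose h t i := expR (- La * t) * i%:R ^+ r.+1 : R.
  (* [expR (- La * a)] is the smallest weight on [[0, a]], so [del * i ^+ r.+1 <= eps * h u i]
     throughout. *)
  pose del := eps * expR (- La * a).
  have del0 : 0 < del by rewrite mulr_gt0 ?expR_gt0.
  (* A bound for [B * i ^+ r] while [i] is below [B / del]; beyond that the higher power
     dominates. *)
  pose D := B * (B / del) ^+ r.
  have D0 : 0 <= D by rewrite mulr_ge0 // exprn_ge0 // divr_ge0 // ltW.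
  have domin (i : nat) : B * i%:R ^+ r <= del * i%:R ^+ r.+1 + D.
    have [hi|hi] := leP (B / del) i%:R.
      rewrite ler_wpDr // exprS mulrA ler_wpM2r ?exprn_ge0 //.
      by rewrite mulrC -ler_pdivrMr.
    apply: (@le_trans _ _ D); last first.
      by rewrite lerDr; apply: mulr_ge0; [exact: ltW | exact: exprn_ge0].
    rewrite /D; apply: ler_wpM2l => //.
    by apply: lerXn2r; rewrite ?nnegrE // ltW // (le_lt_trans _ hi).
  have step K : D * (\sum_(i < K) pr P [set w | Z a w = i]) + sg * (nu a ^+ r * S K) <=
      eps + D + sg * e.
    have := @supersolution_expectation _ _ _ _ Z n b b_bmf bdZ a
      (fun t i => eps * h t i + D + sg * mart a r t i)
      (fun t i => eps * (i%:R ^+ r.+1 * (expR (- La * t) * - La)) + 0 + sg * dmart a r t i) a0.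
    move=> /(_ _ _ _ K) hyp.
    have mart0 : mart a r 0 1 = e.
      by rewrite /mart nu0 mulr1; apply: eq_bigr => k _; rewrite expr1n mulr1.
    have marta i : mart a r a i = i%:R ^+ r * nu a ^+ r.
      rewrite /mart -exprMn; case: (r) r0 => // r' _.
      rewrite big_ord_recl subn0 coef_0 mul1r big1 ?addr0 // => k _.
      by rewrite lift0 coef_itg // itgxx mul0r.
    have {hyp} : \sum_(i < K) (eps * h a i + D + sg * mart a r a i) * pr P [set w | Z a w = i] <=
       eps + D + sg * e.
      rewrite -mart0 -[X in X + D + _]mulr1.
      rewrite -[X in eps * X](_ : h 0 1%N = 1); last first.
        by rewrite /h mulr0 expR0 expr1n mulr1.
      apply: hyp.
      - move=> u i hu.
        have h1 : del * i%:R ^+ r.+1 <= eps * h u i.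
          rewrite /del /h -mulrA ler_wpM2l ?(ltW eps0) // ler_wpM2r ?exprn_ge0 //.
          rewrite ler_expR !mulNr lerN2 ler_wpM2l //; by case/andP: hu.
        have h2 := domin i; have h3 := hB u i hu.
        have h4 : - (sg * mart a r u i) <= B * i%:R ^+ r.
          apply: le_trans (ler_norm _) _; by rewrite normrN normrM sg1 mul1r.
        by clear -h1 h2 h4; lra.
      - move=> i; apply: primD; last by apply: primZ; exact: mart_prim.
        apply: primD; last exact: prim_cst.
        apply: primZ; apply: prim_eq (primZ (i%:R ^+ r.+1) (prim_expdecay a La)) => t _ //.
        by rewrite mulrC.
      - move=> u i hu; rewrite !generatorD !generatorZ generator_cst.
        have := mart_gen a r u i; have := hLa u i hu.
        have := expR_ge0 (- La * u); set x := expR _ => x0 hl hm.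
        have := ler_wpM2l (ltW eps0) (ler_wpM2l x0 hl).
        have : sg * (dmart a r u i + generator n b (mart a r u) u i) = 0 by rewrite hm mulr0.
        rewrite mulrDr; lra.
    apply: le_trans.
    rewrite /S !mulr_sumr -big_split /=; apply: ler_sum => i _.
    rewrite marta !mulrDl -addrA.
    have -> : sg * (nu a ^+ r * (i%:R ^+ r * pr P [set w | Z a w = i])) =
      sg * (i%:R ^+ r * nu a ^+ r) * pr P [set w | Z a w = i] by ring.
    by rewrite lerDr !mulr_ge0 ?pr_ge0 ?(ltW eps0) ?expR_ge0 ?exprn_ge0.
  (* The masses sum to 1 as [K] grows, so [D] occurs equally on both sides and drops out, however
     large it is. *)
  have cv : (fun K => D * (\sum_(i < K) pr P [set w | Z a w = i]) + sg * (nu a ^+ r * S K)) @ \oo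
      --> D * 1 + sg * (nu a ^+ r * limn S).
    apply: cvgD; first by apply: cvgMr; exact: pr_sum_cvg1.
    by apply: cvgMr; apply: cvgMr; exact: cS.
  have : D * 1 + sg * (nu a ^+ r * limn S) <= eps + D + sg * e.
    by apply: (cvgr_to_le cv); apply: nearW => K; exact: step.
  lra.
suff <- : nu a ^+ r * limn S = e by rewrite mulrA mulVf // mul1r.
apply/eqP; rewrite eq_le; apply/andP; split; apply/ler_addgt0Pr => eps eps0.
  by have := key 1 (normr1 _) eps eps0; lra.
by have := key (-1) (normrN1 _) eps eps0; lra.
Qed.

End Moments.

(** * Asymptotics *)

Section Asymptotics.
Context {R : realType}.
Variables (n : nat) (b : int -> R -> R) (Cb c T0 : R).
Hypothesis b_ge0 : forall k t, k \in jumps n -> 0 <= t -> 0 <= b k t.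
Hypothesis b_bmf : forall a k, k \in jumps n -> bmf a (b k).
Hypothesis b_le : forall t, 0 <= t -> total_rate n b t <= Cb.
Hypothesis n_gt0 : (0 < n)%N.
Hypothesis c_gt0 : 0 < c.
Hypothesis T0_ge0 : 0 <= T0.
Hypothesis birth_ge : forall t, T0 <= t -> c <= birth_rate n b t.

Local Notation m := (jump_moment n b).
Local Notation nu := (nu n b).
Local Notation Gam := (Gam n b).
Local Notation q1 := (q1 n b).
Local Notation gfun := (gfun n b).

Hypothesis Gam_pinfty : Gam a @[a --> +oo] --> +oo.
Hypothesis MGam_pinfty : (nu a)^-1 * Gam a @[a --> +oo] --> +oo.

Lemma bernoulli_le (x : R) N : 0 <= x -> x <= 1 -> 1 - N%:R * (1 - x) <= x ^+ N.
Proof.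
move=> x0 x1; elim: N => [|N IH]; first by rewrite mul0r subr0.
rewrite exprS; apply: (@le_trans _ _ (x * (1 - N%:R * (1 - x)))); last first.
  by rewrite ler_wpM2l.
have h : 0 <= (N%:R : R) * (1 - x) ^+ 2 by rewrite mulr_ge0 // sqr_ge0.
rewrite -natr1; move: h; rewrite expr2; lra.
Qed.

(* Avoids cutting the integral of q1 at the time where Gam reaches (1-e) Gam a:
   with x = Gam u / Gam a, the right-hand side integrates in closed form. *)
Lemma min_bound (q x del : R) N : 0 <= q -> q <= 1 -> 0 <= x -> x <= 1 ->
  q * (1 - x) <= del -> q <= x ^+ N + N%:R * del.
Proof.
move=> q0 q1 x0 x1 qx.
have h1 := bernoulli_le N x0 x1.
have h2 : N%:R * (q * (1 - x)) <= N%:R * del by rewrite ler_wpM2l.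
have x0N : 0 <= x ^+ N by exact: exprn_ge0.
set y := N%:R * (1 - x) in h1.
have h3 : q * y <= N%:R * del by rewrite /y mulrCA.
have [y1|y1] := leP y 1.
  have : 0 <= (1 - q) * (1 - y) by rewrite mulr_ge0 // subr_ge0.
  by lra.
have : q <= q * y by rewrite ler_peMr // ltW.
by lra.
Qed.

Lemma total_le_moment2 u : 0 <= u -> total_rate n b u <= m 2 u.
Proof.
move=> u0; rewrite total_rateE /jump_moment !big_seq; apply: ler_sum => k kj.
rewrite ler_peMl ?b_ge0 //; case: (jumpsP kj) => [->|[j /andP[j1 _] ->]].
  by rewrite sqrrN expr1n.
by rewrite -pmulrn -natrX ler1n expn_gt0 j1.
Qed.

Lemma birth_le_total u : 0 <= u -> birth_rate n b u <= total_rate n b u.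
Proof. by move=> u0; rewrite /total_rate lerDr b_ge0 // inE eqxx. Qed.

Lemma total_ge0 u : 0 <= u -> 0 <= total_rate n b u.
Proof.
by move=> u0; rewrite total_rateE big_seq; apply: sumr_ge0 => k kj; exact: b_ge0.
Qed.

Lemma Cb_ge0 : 0 <= Cb.
Proof. exact: le_trans (total_ge0 (lexx 0)) (b_le (lexx 0)). Qed.

Lemma moment2_ge0 u : 0 <= u -> 0 <= m 2 u.
Proof. by move=> u0; apply: le_trans (total_ge0 u0) (total_le_moment2 u0). Qed.

Lemma moment_le j u : 0 <= u -> `|m j u| <= n%:R ^+ j * Cb.
Proof.
move=> u0; apply: le_trans (ler_norm_sum _ _ _) _.
apply: (@le_trans _ _ (\sum_(k <- jumps n) n%:R ^+ j * b k u)).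
  rewrite !big_seq; apply: ler_sum => k kj.
  rewrite normrM normrX [`|b k u|]ger0_norm ?b_ge0 // ler_wpM2r ?b_ge0 //.
  rewrite lerXn2r ?nnegrE //; case: (jumpsP kj) => [->|[i /andP[_ jn] ->]].
    by rewrite mulrN1z normrN1 ler1n.
  by rewrite -pmulrn ger0_norm // ler_nat.
by rewrite -mulr_sumr -total_rateE ler_wpM2l ?exprn_ge0 ?b_le.
Qed.

Definition dGam (u : R) : R := m 2 u * nu u / 2.

Lemma dGam_bmf a : bmf a dGam.
Proof.
apply: bmfM; last exact: bmf_cst.
by apply: bmfM; [exact: moment_bmf | exact: nu_bmf].
Qed.

Lemma dGam_ge0 u : 0 <= u -> 0 <= dGam u.
Proof.
by move=> u0; rewrite /dGam !mulr_ge0 ?moment2_ge0 ?invr_ge0 // ltW // nu_gt0.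
Qed.

Lemma Gam_prim a : primitive a Gam dGam.
Proof. exact: prim_itg (dGam_bmf a). Qed.

Lemma GamB s t : 0 <= s -> s <= t -> itg dGam s t = Gam t - Gam s.
Proof. by move=> s0 st; rewrite (Gam_prim t).2. Qed.

Lemma le_Gam s t : 0 <= s -> s <= t -> Gam s <= Gam t.
Proof.
move=> s0 st; rewrite -subr_ge0 -GamB //; apply: itg_ge0 => u /andP[su _].
by rewrite dGam_ge0 // (le_trans s0).
Qed.

Lemma Gam0 : Gam 0 = 0. Proof. exact: itgxx. Qed.

Lemma Gam_ge0 t : 0 <= t -> 0 <= Gam t.
Proof. by move=> t0; rewrite -Gam0; exact: le_Gam. Qed.

(** Converts integrals against [nu] into integrals against [dGam], which [Gam] evaluates in closed
    form. *)
Lemma nu_le_dGam u : T0 <= u -> nu u <= 2 / c * dGam u.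
Proof.
move=> Tu; have u0 := le_trans T0_ge0 Tu.
have hc : c <= m 2 u.
  by apply: le_trans (birth_ge Tu) _; apply: le_trans (birth_le_total u0) (total_le_moment2 u0).
have -> : 2 / c * dGam u = m 2 u / c * nu u by rewrite /dGam; field; rewrite gt_eqF.
rewrite ler_peMl ?(ltW (nu_gt0 _ _ _)) // ler_pdivlMr // mul1r //.
Qed.

(** [nu / Gam] is the reciprocal of the quantity that [MGam_pinfty] sends to infinity. *)
Lemma nu_negligible (del : R) : 0 < del ->
  exists2 T1, T0 <= T1 & forall u, T1 <= u -> nu u <= del * Gam u.
Proof.
move=> del0; move/cvgryPge : MGam_pinfty => /(_ del^-1) [T [_ hT]].
exists (Num.max T0 (T + 1)); first by rewrite le_max lexx.
move=> u; rewrite ge_max => /andP[_ Tu].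
have /hT : T < u by apply: lt_le_trans Tu; rewrite ltrDl.
have := nu_gt0 n b u; set x := nu u => x0.
by rewrite mulrC ler_pdivlMr // mulrC ler_pdivrMr // mulrC.
Qed.

Lemma Gam_large (A : R) : \forall a \near +oo, A <= Gam a.
Proof. by move/cvgryPge : Gam_pinfty; apply. Qed.

(** One factor [nu] becomes [dGam] and integrates to at most a multiple of [Gam a]; each of the
    other [l.+1] factors is at most [del * Gam a]. *)
Lemma itg_nu_pow_small l (e : R) : 0 < e ->
  \forall a \near +oo, itg (fun u => nu u ^+ l.+2) 0 a <= e * Gam a ^+ l.+2.
Proof.
(* The bound 1 gives [del ^+ l.+1 <= del]; the bound [e * c / 4] turns [2 / c * del] into at most
   [e / 2]. *)
move=> e0; pose del := Num.min 1 (e * c / 4).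
have del0 : 0 < del by rewrite lt_min ltr01 divr_gt0 // mulr_gt0.
have [T1 T01 hT1] := nu_negligible del0.
have T10 : 0 <= T1 by exact: le_trans T01.
near=> a.
have aT1 : T1 <= a by near: a; apply: nbhs_pinfty_ge; rewrite num_real.
have G1 : 1 <= Gam a by near: a; exact: Gam_large.
have GD : itg (fun u => nu u ^+ l.+2) 0 T1 / (e / 2) <= Gam a by near: a; exact: Gam_large.
have bnl : bmf a (fun u => nu u ^+ l.+2) by apply: bmfX; exact: nu_bmf.
rewrite (itg_chasles bnl (lexx 0) T10 aT1 (lexx a)).
have h1 : itg (fun u => nu u ^+ l.+2) 0 T1 <= e / 2 * Gam a ^+ l.+2.
  move: GD; rewrite ler_pdivrMr ?divr_gt0 // => /le_trans; apply.
  by rewrite mulrC ler_wpM2l ?divr_ge0 ?(ltW e0) // ler_eXnr.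
have h2 : itg (fun u => nu u ^+ l.+2) T1 a <= e / 2 * Gam a ^+ l.+2.
  have K0 : 0 <= 2 / c * (del * Gam a) ^+ l.+1.
    rewrite mulr_ge0 ?divr_ge0 ?(ltW c_gt0) // exprn_ge0 // mulr_ge0 ?(ltW del0) //.
    exact: le_trans G1.
  apply: (@le_trans _ _ (itg (fun u => 2 / c * (del * Gam a) ^+ l.+1 * dGam u) T1 a)).
    apply: (@le_itg _ a) => //; first exact/bmfZ/dGam_bmf.
    move=> u /andP[Tu ua]; rewrite exprS mulrAC.
    apply: ler_pM; rewrite ?exprn_ge0 ?(ltW (nu_gt0 _ _ _)) //.
      by apply: nu_le_dGam; exact: le_trans Tu.
    rewrite lerXn2r ?nnegrE ?(ltW (nu_gt0 _ _ _)) //.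
      by rewrite mulr_ge0 ?(ltW del0) // (le_trans _ G1).
    apply: le_trans (hT1 u Tu) _; rewrite ler_wpM2l ?(ltW del0) //.
    by apply: le_Gam => //; exact: le_trans Tu.
  rewrite (@itgZ _ a) ?GamB //; last exact: dGam_bmf.
  apply: (@le_trans _ _ (2 / c * (del * Gam a) ^+ l.+1 * Gam a)).
    by rewrite ler_wpM2l // gerBl Gam_ge0.
  rewrite exprMn [Gam a ^+ l.+2]exprSr !mulrA.
  have G0 : 0 <= Gam a by exact: le_trans G1.
  rewrite ler_wpM2r // ler_wpM2r ?exprn_ge0 //.
  apply: (@le_trans _ _ (2 / c * del)).
    rewrite ler_wpM2l ?divr_ge0 ?(ltW c_gt0) // exprS ler_piMr ?(ltW del0) //.
    by rewrite exprn_ile1 ?(ltW del0) // ge_min lexx.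
  apply: (@le_trans _ _ (2 / c * (e * c / 4))).
    by rewrite ler_wpM2l ?divr_ge0 ?(ltW c_gt0) // ge_min lexx orbT.
  rewrite le_eqVlt; apply/orP; left; apply/eqP; field.
  by rewrite gt_eqF.
lra.
Unshelve. all: by end_near. Qed.

Lemma gfun0_bmf a : bmf a (gfun 0).
Proof. by apply: (@gfun_bmf _ _ _ b_bmf a (fun=> 0)); exact: bmf_cst. Qed.

Lemma q1_prim_ge a t : 0 <= t <= a -> nu t <= nu a + itg (fun u => nu u * gfun 0 u) t a.
Proof. exact: (tail_ge b_ge0 b_bmf (gfun0_bmf a) (fun t ht => lexx _)). Qed.

Lemma q1_ge0 a t : 0 <= t <= a -> 0 <= q1 a t.
Proof.
move=> ht; rewrite divr_ge0 ?(ltW (nu_gt0 _ _ _)) //.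
by apply: le_trans (q1_prim_ge ht); rewrite (ltW (nu_gt0 _ _ _)).
Qed.

Lemma q1_le1 a t : 0 <= t <= a -> q1 a t <= 1.
Proof.
move=> ht; rewrite ler_pdivrMr ?mul1r ?q1_prim_ge //.
by apply: lt_le_trans (q1_prim_ge ht); exact: nu_gt0.
Qed.

Lemma q1_bmf a : bmf a (q1 a).
Proof.
have := slope_prim b_bmf (tail_prim b_bmf (gfun0_bmf a)) (@q1_prim_ge a).
move=> /prim_bmf /(bmfB (bmf_cst a 1)).
by under eq_fun do rewrite subKr.
Qed.

(** Past [T0] one has [gfun 0 >= c], and [c] dominates a multiple of the bounded [m 2]; so the
    denominator of [q1] at [u] is at least a multiple of [Gam a - Gam u]. *)
Lemma q1_decay : exists2 kap, 0 < kap & forall a u, T0 <= u -> u <= a ->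
  kap * (q1 a u * (Gam a - Gam u)) <= nu u.
Proof.
pose C2 := n%:R ^+ 2 * Cb + 1.
have C20 : 0 < C2 by rewrite ltr_wpDl // mulr_ge0 ?exprn_ge0 ?Cb_ge0.
exists (2 * c / C2); first by rewrite divr_gt0 // mulr_gt0.
move=> a u Tu ua; have u0 : 0 <= u := le_trans T0_ge0 Tu.
have hu : 0 <= u <= a by rewrite u0.
have w0 : 0 < nu a + itg (fun u => nu u * gfun 0 u) u a.
  by apply: lt_le_trans (q1_prim_ge hu); exact: nu_gt0.
have h : 2 * c / C2 * (Gam a - Gam u) <= nu a + itg (fun u => nu u * gfun 0 u) u a.
  apply: ler_wpDl; first exact: ltW (nu_gt0 _ _ _).
  rewrite -GamB // -(@itgZ _ a) //; last exact: dGam_bmf.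
  apply: (@le_itg _ a) => //; first exact/bmfZ/dGam_bmf.
    by apply: bmfM; [exact: nu_bmf | exact: gfun0_bmf].
  move=> v /andP[uv va]; have v0 := le_trans u0 uv.
  have -> : 2 * c / C2 * dGam v = nu v * (c * (m 2 v / C2)).
    by rewrite /dGam; field; rewrite gt_eqF.
  rewrite ler_wpM2l ?(ltW (nu_gt0 _ _ _)) //.
  apply: (@le_trans _ _ c).
    rewrite ler_piMr ?(ltW c_gt0) // ler_pdivrMr // mul1r.
    apply: le_trans (ler_norm _) _; apply: le_trans (moment_le 2 v0) _.
    by rewrite /C2 lerDl.
  apply: le_trans (birth_ge (le_trans Tu uv)) _; exact: birth_le_gfun0.
rewrite mulrCA; apply: le_trans (ler_wpM2l (q1_ge0 hu) h) _.
by rewrite /q1 divfK // gt_eqF.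
Qed.

(** By [q1_decay], [q1 a u] is small unless [Gam u] is close to [Gam a], and such [u] carry little
    of the total [Gam a]. The fixed stretch [[0, T1]] is absorbed because [Gam] diverges. *)
Lemma itg_nu_q1_small (e : R) : 0 < e ->
  \forall a \near +oo, itg (fun u => nu u * q1 a u) 0 a <= e * Gam a.
Proof.
move=> e0; have [kap kap0 hkap] := q1_decay.
(* [N] bounds the contribution of [(Gam u / Gam a) ^+ N] by [e / 4 * Gam a], and [del] does the same
   for [N * del]; the factor [2 / c] of [nu_le_dGam] is included. *)
have [N hN] : exists N : nat, 8 / (c * e) < N%:R.
  by exists (Num.bound (8 / (c * e))); rewrite archi_boundP // divr_ge0 // ltW // mulr_gt0.
pose del := c * e / (8 * N.+1%:R).
have del0 : 0 < del by rewrite divr_gt0 ?mulr_gt0.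
have [T1 T01 hT1] := nu_negligible (mulr_gt0 kap0 del0).
have T10 : 0 <= T1 by exact: le_trans T01.
near=> a.
have aT1 : T1 <= a by near: a; apply: nbhs_pinfty_ge; rewrite num_real.
have G1 : 1 <= Gam a by near: a; exact: Gam_large.
have GD : itg nu 0 T1 / (e / 2) <= Gam a by near: a; exact: Gam_large.
have G0 : 0 < Gam a by exact: lt_le_trans G1.
have bn : bmf a nu by exact: nu_bmf.
have bnq : bmf a (fun u => nu u * q1 a u) by apply: bmfM => //; exact: q1_bmf.
rewrite (itg_chasles bnq (lexx 0) T10 aT1 (lexx a)).
have h1 : itg (fun u => nu u * q1 a u) 0 T1 <= e / 2 * Gam a.
  move: GD; rewrite ler_pdivrMr ?divr_gt0 // mulrC; apply: le_trans.
  apply: (@le_itg _ a) => // u /andP[u0 uT].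
  by rewrite ler_piMr ?(ltW (nu_gt0 _ _ _)) // q1_le1 // u0 (le_trans uT).
have bG : bmf a Gam by exact: prim_bmf (Gam_prim a).
have bGN : bmf a (fun u => Gam u ^+ N * dGam u).
  by apply: bmfM; [exact: bmfX | exact: dGam_bmf].
have h2 : itg (fun u => nu u * q1 a u) T1 a <= e / 2 * Gam a.
  apply: (@le_trans _ _ (itg (fun u => 2 / c * (Gam a ^- N * (Gam u ^+ N * dGam u) +
     N%:R * del * dGam u)) T1 a)).
    apply: (@le_itg _ a) => //.
      by apply: bmfZ; apply: bmfD; [exact: bmfZ | exact/bmfZ/dGam_bmf].
    move=> u /andP[Tu ua]; have u0 : 0 <= u by exact: le_trans Tu.
    have hu : 0 <= u <= a by rewrite u0.
    have Tu0 : T0 <= u by exact: le_trans Tu.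
    pose x := Gam u / Gam a.
    have x0 : 0 <= x by rewrite divr_ge0 ?Gam_ge0 // ltW.
    have x1 : x <= 1 by rewrite ler_pdivrMr // mul1r le_Gam.
    have qx : q1 a u * (1 - x) <= del.
      rewrite -(ler_pM2l (mulr_gt0 kap0 G0)).
      have -> : kap * Gam a * (q1 a u * (1 - x)) = kap * (q1 a u * (Gam a - Gam u)).
        by rewrite /x; field; rewrite gt_eqF.
      apply: le_trans (hkap a u Tu0 ua) _; apply: le_trans (hT1 u Tu) _.
      have -> : kap * Gam a * del = kap * del * Gam a by ring.
      by rewrite ler_wpM2l ?le_Gam // ltW // mulr_gt0.
    have hq := min_bound N (q1_ge0 hu) (q1_le1 hu) x0 x1 qx.
    have -> : 2 / c * (Gam a ^- N * (Gam u ^+ N * dGam u) + N%:R * del * dGam u) =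
      2 / c * dGam u * (x ^+ N + N%:R * del) by rewrite /x exprMn exprVn; ring.
    apply: ler_pM => //; rewrite ?q1_ge0 ?(ltW (nu_gt0 _ _ _)) //.
    exact: nu_le_dGam.
  rewrite (@itgZ _ a) //; last by apply: bmfD; [exact: bmfZ | exact/bmfZ/dGam_bmf].
  rewrite (@itgD _ a) //; [|exact: bmfZ|exact/bmfZ/dGam_bmf].
  rewrite (itgZ (Gam a ^- N) bGN T10 (lexx a)) (itgZ (N%:R * del) (dGam_bmf a) T10 (lexx a)) GamB //.
  have hp : itg (fun u => Gam u ^+ N * dGam u) T1 a <= Gam a ^+ N.+1 / N.+1%:R.
    have [_ /(_ T1 a T10 aT1 (lexx _))] := primX N.+1 (Gam_prim a).
    have -> : itg (fun u => N.+1%:R * Gam u ^+ N.+1.-1 * dGam u) T1 a =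
       N.+1%:R * itg (fun u => Gam u ^+ N * dGam u) T1 a.
      by rewrite -(@itgZ _ a) //; apply: eq_itg => u _; rewrite mulrA.
    move=> E; rewrite ler_pdivlMr // mulrC -E gerBl exprn_ge0 // Gam_ge0 //.
  have GN0 : 0 <= Gam a ^- N by rewrite invr_ge0 exprn_ge0 // ltW.
  have k1 := ler_wpM2l GN0 hp.
  have k2 : N%:R * del * (Gam a - Gam T1) <= N%:R * del * Gam a.
    by rewrite ler_wpM2l ?gerBl ?Gam_ge0 // mulr_ge0 // ltW.
  apply: le_trans (ler_wpM2l _ (lerD k1 k2)) _; first by rewrite divr_ge0 // ltW.
  have -> : Gam a ^- N * (Gam a ^+ N.+1 / N.+1%:R) = Gam a / N.+1%:R.
    by rewrite exprSr; field; rewrite expf_neq0 gt_eqF.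
  have ce0 : 0 < c * e by rewrite mulr_gt0.
  have k3 : 2 / c / N.+1%:R <= e / 4.
    rewrite ler_pdivrMr // ler_pdivrMr //.
    have -> : e / 4 * N.+1%:R * c = (N%:R * (c * e) + c * e) / 4 by rewrite -natr1; field.
    by move: hN; rewrite ltr_pdivrMr //; lra.
  have k4 : 2 / c * (N%:R * del) <= e / 4.
    have -> : 2 / c * (N%:R * del) = e / 4 * (N%:R / N.+1%:R).
      have y0 : (N.+1%:R : R) != 0 by rewrite pnatr_eq0.
      have c0 := lt0r_neq0 c_gt0; rewrite /del.
      by field; rewrite nat1r y0 c0.
    rewrite ler_piMr ?divr_ge0 ?(ltW e0) // ler_pdivrMr // mul1r ler_nat //.
  have -> : 2 / c * (Gam a / N.+1%:R + N%:R * del * Gam a) =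
     (2 / c / N.+1%:R + 2 / c * (N%:R * del)) * Gam a by ring.
  rewrite ler_wpM2r ?(ltW G0) //; apply: le_trans (lerD k3 k4) _.
  by rewrite le_eqVlt; apply/orP; left; apply/eqP; field.
rewrite [e](splitr e) mulrDl; exact: lerD.
Unshelve. all: by end_near. Qed.

Lemma near_ge (A : R) : \forall a \near +oo, A <= a.
Proof. by apply: nbhs_pinfty_ge; rewrite num_real. Qed.

(** * Leading order of the moment coefficients *)

Section Coefficients.
Variable r : nat.

(** The Lah numbers [L(r, r - k)]. [kapS] is the recursion left when only the second jump moment is
    kept, and [kap r.-1 = r!] is the origin of the exponential moments. *)
Definition kap (k : nat) : R := (r ^_ k * 'C(r.-1, k))%:R.

Lemma kap_ge0 k : 0 <= kap k. Proof. exact: ler0n. Qed.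

Lemma kapS k : (k < r)%N -> kap k.+1 * k.+1%:R = kap k * ('C(r - k, 2) * 2)%:R.
Proof.
move=> kr; rewrite /kap -!natrM; congr (_%:R).
have e1 := mul_bin_left r.-1 k; have e2 := mul_bin_diag (r - k) 1.
rewrite bin1 in e2.
rewrite ffactnSr -mulnA [('C(_, k.+1) * _)%N]mulnC e1 [('C(_, 2) * _)%N]mulnC -e2.
have -> : (r.-1 - k = (r - k).-1)%N by lia.
by ring.
Qed.

Lemma kap_last : (0 < r)%N -> kap r.-1 = r`!%:R.
Proof.
move=> r0; rewrite /kap binn muln1; congr (_%:R).
by rewrite -ffactnn -[in RHS](prednK r0) ffactnSr subSnn muln1 prednK.
Qed.

Lemma norm_itg_le (a : R) (f g : R -> R) s t : bmf a f -> bmf a g -> 0 <= s -> t <= a ->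
  (forall u, s <= u <= t -> `|f u| <= g u) -> `|itg f s t| <= itg g s t.
Proof.
move=> bf bg s0 ta h; rewrite ler_norml -(@itgN _ a) //; apply/andP; split.
  apply: (@le_itg _ a) => //; first exact: bmfN.
  by move=> u /h; rewrite ler_norml => /andP[].
apply: (@le_itg _ a) => // u /h; exact: le_trans (ler_norm _).
Qed.

Lemma itg_Gam_pow k a t : 0 <= t <= a ->
  itg (fun u => (Gam a - Gam u) ^+ k * dGam u) t a = (Gam a - Gam t) ^+ k.+1 / k.+1%:R.
Proof.
move=> /andP[t0 ta].
have bG : bmf a (fun u => (Gam a - Gam u) ^+ k * dGam u).
  apply: bmfM; last exact: dGam_bmf.
  apply: bmfX; apply: bmfB; [exact: bmf_cst | exact: prim_bmf (Gam_prim a)].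
have := primX k.+1 (primD (prim_cst a (Gam a)) (primN (Gam_prim a))).
move=> [_ /(_ t a t0 ta (lexx _))].
rewrite subrr expr0n sub0r.
have -> : itg (fun u => k.+1%:R * (Gam a - Gam u) ^+ k.+1.-1 * (0 - dGam u)) t a =
   - k.+1%:R * itg (fun u => (Gam a - Gam u) ^+ k * dGam u) t a.
  by rewrite -(itgZ (- k.+1%:R) bG t0 (lexx a)); apply: eq_itg => u _ /=; ring.
rewrite mulNr => /oppr_inj ->.
by rewrite mulrC mulKf // pnatr_eq0.
Qed.

(** In [dcoef k.+1] only the term of [coef k] carries a single [nu], through [dGam]; [itg_Gam_pow]
    and [kapS] evaluate it. The others carry [nu ^+ l.+2] and are negligible. Uniformity in [t] is
    needed because [coef k] enters under an integral. *)
Lemma coef_asymptotics k : (k < r)%N -> forall e : R, 0 < e ->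
  \forall a \near +oo, forall t, 0 <= t <= a ->
    `|coef n b a r k t - kap k * (Gam a - Gam t) ^+ k| <= e * Gam a ^+ k.
Proof.
elim/ltn_ind: k => -[|k] IH kr e e0.
  apply: nearW => a t _; rewrite coef_0 /kap ffactn0 bin0 muln1 !expr0 !mulr1 subrr normr0.
  exact: ltW.
pose Q : R := ('C(r - k, 2) * 2)%:R.
have Q0 : 0 <= Q by exact: ler0n.
(* [e1] keeps the leading error [Q * e1] below [e / 2]; [e2] does the same for the other terms, with
   [B1] bounding the earlier coefficients and [B2] the rates. *)
pose e1 := e / (2 * (Q + 1)).
have e10 : 0 < e1 by rewrite divr_gt0 // mulr_gt0 // ltr_wpDl.
pose B1 := \sum_(i < k.+1) (kap i + 1).
have B10 : 0 <= B1 by apply: sumr_ge0 => i _; rewrite addr_ge0 ?kap_ge0.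
pose B2 l := 'C(r - (k - l.+1), l.+3)%:R * (n%:R ^+ l.+3 * Cb).
have B20 l : 0 <= B2 l.
  by apply: mulr_ge0 => //; apply: mulr_ge0; [exact: exprn_ge0 | exact: Cb_ge0].
pose S2 := \sum_(l < k) B2 l.
have S20 : 0 <= S2 by exact: sumr_ge0.
pose e2 := e / (2 * (B1 * S2 + 1)).
have e20 : 0 < e2 by rewrite divr_gt0 // mulr_gt0 // ltr_wpDl // mulr_ge0.
have near1 : \forall a \near +oo, forall t, 0 <= t <= a ->
    `|coef n b a r k t - kap k * (Gam a - Gam t) ^+ k| <= e1 * Gam a ^+ k.
  by apply: IH => //; exact: ltnW.
have near2 : \forall a \near +oo, forall i, i \in iota 0 k.+1 -> forall t, 0 <= t <= a ->
    `|coef n b a r i t - kap i * (Gam a - Gam t) ^+ i| <= 1 * Gam a ^+ i.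
  apply: near_all_seq => i; rewrite mem_iota add0n => /andP[_ ik].
  by apply: IH => //; exact: leq_trans (ltnW kr).
have near3 : \forall a \near +oo, forall l, l \in iota 0 k ->
    itg (fun u => nu u ^+ l.+2) 0 a <= e2 * Gam a ^+ l.+2.
  by apply: near_all_seq => l _; exact: itg_nu_pow_small.
have near4 : \forall a \near (+oo : set_system R), 0 <= a by exact: near_ge.
apply: filterS2 (filterI near1 near2) (filterI near3 near4) => a [h1 h2] [h3 a0] t ht.
have /andP[t0 ta] := ht.
have G0 : 0 <= Gam a by exact: Gam_ge0.
pose main u := Q * kap k * ((Gam a - Gam u) ^+ k * dGam u).
have bGk : bmf a (fun u => (Gam a - Gam u) ^+ k * dGam u).
  apply: bmfM; last exact: dGam_bmf.
  apply: bmfX; apply: bmfB; [exact: bmf_cst | exact: prim_bmf (Gam_prim a)].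
have bmain : bmf a main by exact: bmfZ.
have bd : bmf a (dcoef n b a r k.+1) by exact: dcoef_bmf.
have -> : kap k.+1 * (Gam a - Gam t) ^+ k.+1 = itg main t a.
  rewrite /main (itgZ (Q * kap k) bGk t0 (lexx a)) itg_Gam_pow //.
  rewrite [Q * _]mulrC -kapS 1?ltnW // mulrA mulrAC mulrK //.
  by rewrite unitfE pnatr_eq0.
rewrite coef_itg // -(itgB bd bmain t0 (lexx a)).
pose E u := Q * e1 * Gam a ^+ k * dGam u +
  \sum_(l < k) B1 * B2 l * Gam a ^+ (k - l.+1) * nu u ^+ l.+2.
have bnu l : bmf a (fun u => nu u ^+ l.+2) by apply: bmfX; exact: nu_bmf.
have bE1 : bmf a (fun u => Q * e1 * Gam a ^+ k * dGam u) by exact/bmfZ/dGam_bmf.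
have bE2 : bmf a (fun u => \sum_(l < k) B1 * B2 l * Gam a ^+ (k - l.+1) * nu u ^+ l.+2).
  by apply: bmf_sum => l _; exact: bmfZ.
have bE : bmf a E by exact: bmfD.
have E0 u : 0 <= u <= a -> 0 <= E u.
  move=> /andP[u0 _]; apply: addr_ge0.
    apply: mulr_ge0; last exact: dGam_ge0.
    by apply: mulr_ge0; [apply: mulr_ge0 => //; exact: ltW | exact: exprn_ge0].
  apply: sumr_ge0 => l _; apply: mulr_ge0; last by rewrite exprn_ge0 // ltW // nu_gt0.
  by apply: mulr_ge0; [exact: mulr_ge0 | exact: exprn_ge0].
have DE u : t <= u <= a -> `|dcoef n b a r k.+1 u - main u| <= E u.
  move=> /andP[tu ua]; have u0 : 0 <= u by exact: le_trans tu.
  have hu : 0 <= u <= a by rewrite u0.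
  have nu0 := nu_gt0 n b u.
  rewrite /dcoef big_ord_recl /= subSS subn0.
  have -> : rate_coef n b (r - k) 1 u = Q * dGam u.
    by rewrite /rate_coef /Q /dGam natrM expr1; field.
  rewrite -addrA addrCA addrC /E; apply: le_trans (ler_normD _ _) _; apply: lerD.
    have -> : coef n b a r k u * (Q * dGam u) - main u =
      (coef n b a r k u - kap k * (Gam a - Gam u) ^+ k) * (Q * dGam u).
      by rewrite /main; ring.
    have Qd : 0 <= Q * dGam u by rewrite mulr_ge0 // dGam_ge0.
    rewrite normrM (ger0_norm Qd).
    have -> : Q * e1 * Gam a ^+ k * dGam u = e1 * Gam a ^+ k * (Q * dGam u) by ring.
    by rewrite ler_wpM2r // h1.
  apply: le_trans (ler_norm_sum _ _ _) _; apply: ler_sum => l _.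
  have lk := ltn_ord l; rewrite /bump /= add1n subSS.
  have -> : B1 * B2 l * Gam a ^+ (k - l.+1) * nu u ^+ l.+2 =
     B1 * Gam a ^+ (k - l.+1) * (B2 l * nu u ^+ l.+2) by ring.
  rewrite normrM; apply: ler_pM => //.
    have lk' : (k - l.+1)%N \in iota 0 k.+1.
      by rewrite mem_iota add0n ltnS leq_subr.
    have h := h2 _ lk' u hu; rewrite mul1r in h.
    set i := (k - l.+1)%N in h *.
    have -> : coef n b a r i u = (coef n b a r i u - kap i * (Gam a - Gam u) ^+ i) +
       kap i * (Gam a - Gam u) ^+ i by rewrite subrK.
    apply: le_trans (ler_normD _ _) _.
    have hG : 0 <= Gam a - Gam u by rewrite subr_ge0 le_Gam.
    have hk : `|kap i * (Gam a - Gam u) ^+ i| <= kap i * Gam a ^+ i.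
      rewrite ger0_norm ?mulr_ge0 ?kap_ge0 ?exprn_ge0 // ler_wpM2l ?kap_ge0 //.
      by rewrite lerXn2r ?nnegrE // gerBl Gam_ge0.
    apply: le_trans (lerD h hk) _; rewrite -{1}[Gam a ^+ i]mul1r -mulrDl addrC.
    rewrite ler_wpM2r ?exprn_ge0 // /B1.
    have ik : (i < k.+1)%N by rewrite /i ltnS leq_subr.
    rewrite (bigD1 (Ordinal ik)) //= lerDl; apply: sumr_ge0 => j _.
    by rewrite addr_ge0 ?kap_ge0.
  rewrite /rate_coef /B2 normrM (ger0_norm (exprn_ge0 _ (ltW nu0))) normrM normr_nat -mulrA.
  rewrite -[leRHS]mulrA; apply: ler_wpM2l => //.
  apply: ler_wpM2r; [by rewrite exprn_ge0 // ltW | exact: moment_le].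
apply: le_trans (norm_itg_le (bmfB bd bmain) bE t0 (lexx a) DE) _.
(* Enlarging the range to [[0, a]] makes the bound independent of [t]. *)
apply: (@le_trans _ _ (itg E 0 a)).
  rewrite [leRHS](itg_chasles bE (lexx 0) t0 ta (lexx a)) lerDr.
  by apply: itg_ge0 => u /andP[u0 ut]; rewrite E0 // u0 (le_trans ut).
rewrite /E (itgD bE1 bE2 (lexx 0) (lexx a)).
rewrite (itgZ (Q * e1 * Gam a ^+ k) (dGam_bmf a) (lexx 0) (lexx a)) GamB // Gam0 subr0.
rewrite (@itg_sum _ a) //; last by move=> l _; exact: bmfZ.
have k1 : Q * e1 * Gam a ^+ k * Gam a <= e / 2 * Gam a ^+ k.+1.
  rewrite -mulrA -exprSr ler_wpM2r ?exprn_ge0 // /e1 mulrA ler_pdivrMr; last first.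
    by rewrite mulr_gt0 // ltr_wpDl.
  have -> : e / 2 * (2 * (Q + 1)) = Q * e + e by field.
  by rewrite lerDl ltW.
have k2 : \sum_(l < k) itg (fun u => B1 * B2 l * Gam a ^+ (k - l.+1) * nu u ^+ l.+2) 0 a <=
    e / 2 * Gam a ^+ k.+1.
  apply: (@le_trans _ _ (\sum_(l < k) B1 * e2 * Gam a ^+ k.+1 * B2 l)).
    apply: ler_sum => l _.
    rewrite (itgZ (B1 * B2 l * Gam a ^+ (k - l.+1)) (bnu l) (lexx 0) (lexx a)).
    have lk := ltn_ord l.
    have -> : B1 * e2 * Gam a ^+ k.+1 * B2 l =
       B1 * B2 l * Gam a ^+ (k - l.+1) * (e2 * Gam a ^+ l.+2).
      have -> : (k.+1 = (k - l.+1) + l.+2)%N by rewrite addnS subnK.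
      by rewrite exprD; ring.
    apply: ler_wpM2l; last by apply: h3; rewrite mem_iota.
    by apply: mulr_ge0; [exact: mulr_ge0 | exact: exprn_ge0].
  rewrite -mulr_sumr -/S2.
  have -> : B1 * e2 * Gam a ^+ k.+1 * S2 = B1 * S2 * e2 * Gam a ^+ k.+1 by ring.
  rewrite ler_wpM2r ?exprn_ge0 // /e2 mulrA ler_pdivrMr; last first.
    by rewrite mulr_gt0 // ltr_wpDl // mulr_ge0.
  have -> : e / 2 * (2 * (B1 * S2 + 1)) = B1 * S2 * e + e by field.
  by rewrite lerDl ltW.
by apply: le_trans (lerD k1 k2) _; rewrite -mulrDl -splitr.
Qed.

(** The terms with [k < r.-1] are of order [Gam a ^+ k], hence at least one factor [Gam a] short of
    the last one. *)
Lemma sum_coef_asymptotics (e : R) : (0 < r)%N -> 0 < e -> \forall a \near +oo,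
  `|\sum_(k < r) coef n b a r k 0 - r`!%:R * Gam a ^+ r.-1| <= e * Gam a ^+ r.-1.
Proof.
move=> r0 e0.
pose B := \sum_(k < r.-1) (kap k + 1).
have B0 : 0 <= B by apply: sumr_ge0 => k _; rewrite addr_ge0 ?kap_ge0.
have near1 : \forall a \near +oo, forall t, 0 <= t <= a ->
    `|coef n b a r r.-1 t - kap r.-1 * (Gam a - Gam t) ^+ r.-1| <= e / 2 * Gam a ^+ r.-1.
  by apply: coef_asymptotics; rewrite ?divr_gt0 // prednK.
have near2 : \forall a \near +oo, forall i, i \in iota 0 r.-1 -> forall t, 0 <= t <= a ->
    `|coef n b a r i t - kap i * (Gam a - Gam t) ^+ i| <= 1 * Gam a ^+ i.
  apply: near_all_seq => i; rewrite mem_iota add0n => /andP[_ ik].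
  by apply: coef_asymptotics => //; lia.
near=> a.
have a0 : 0 <= a by near: a; exact: near_ge.
have G1 : 1 <= Gam a by near: a; exact: Gam_large.
have GB : B / (e / 2) <= Gam a by near: a; exact: Gam_large.
have h00 : (0 : R) <= 0 <= a by rewrite a0 lexx.
have h1 : `|coef n b a r r.-1 0 - kap r.-1 * Gam a ^+ r.-1| <= e / 2 * Gam a ^+ r.-1.
  have h1 : forall t, 0 <= t <= a ->
    `|coef n b a r r.-1 t - kap r.-1 * (Gam a - Gam t) ^+ r.-1| <= e / 2 * Gam a ^+ r.-1 by near: a.
  by have := h1 0 h00; rewrite Gam0 subr0.
have G0 : 0 < Gam a by exact: lt_le_trans G1.
have h2 i : (i < r.-1)%N -> `|coef n b a r i 0| <= (kap i + 1) * (Gam a ^+ r.-1 / Gam a).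
  have h2 : forall i, i \in iota 0 r.-1 -> forall t, 0 <= t <= a ->
    `|coef n b a r i t - kap i * (Gam a - Gam t) ^+ i| <= 1 * Gam a ^+ i by near: a.
  move=> ir; have := h2 i; rewrite mem_iota /= add0n ir => /(_ isT 0 h00).
  rewrite Gam0 subr0 => h.
  rewrite -[coef _ _ _ _ _ _](subrK (kap i * Gam a ^+ i)).
  apply: le_trans (ler_normD _ _) _.
  have hk : `|kap i * Gam a ^+ i| <= kap i * Gam a ^+ i.
    by rewrite ger0_norm // mulr_ge0 ?kap_ge0 // exprn_ge0 // ltW.
  apply: le_trans (lerD h hk) _; rewrite -mulrDl addrC ler_wpM2l ?addr_ge0 ?kap_ge0 //.
  by rewrite ler_pdivlMr // -exprSr ler_weXn2l.
have -> : \sum_(k < r) coef n b a r k 0 = \sum_(k < r.-1) coef n b a r k 0 + coef n b a r r.-1 0.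
  move: (coef n b a r) => F; case: (r) r0 => // r' _.
  by rewrite big_ord_recr.
rewrite -kap_last // -addrA; apply: le_trans (ler_normD _ _) _.
have hs : `|\sum_(k < r.-1) coef n b a r k 0| <= e / 2 * Gam a ^+ r.-1.
  apply: le_trans (ler_norm_sum _ _ _) _.
  apply: (@le_trans _ _ (\sum_(k < r.-1) (kap k + 1) * (Gam a ^+ r.-1 / Gam a))).
    by apply: ler_sum => i _; exact: h2.
  rewrite -mulr_suml -/B mulrCA mulrC ler_wpM2r ?exprn_ge0 ?(ltW G0) //.
  by rewrite ler_pdivrMr // mulrC -ler_pdivrMr // divr_gt0.
by apply: le_trans (lerD hs h1) _; rewrite -mulrDl -splitr.
Unshelve. all: by end_near. Qed.

End Coefficients.
End Asymptotics.

(** * Expectations of integer-valued random variables *)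

Section NatRV.
Context {R : realType} {d : measure_display} {T : measurableType d}.
Variable P : probability T R.

(** Countable additivity over the level sets of [X]; every set of integers is measurable, so [g] is
    arbitrary. *)
Lemma expectation_nat (X : {RV P >-> nat}) (g : nat -> R) (l : R) :
  (forall i, 0 <= g i) ->
  (fun K => \sum_(i < K) g i * pr P [set w | X w = i]) @ \oo --> l ->
  ('E_P[fun w => g (X w)] = l%:E)%E.
Proof.
move=> g0 cvl; rewrite unlock.
have mX (i : nat) : measurable [set w | X w = i] by exact: (measurable_RV_nat X [set i]).
have U : \bigcup_i [set w | X w = i] = [set: T].
  by apply/seteqP; split => // w _; exists (X w).
have mg : measurable_fun [set: T] (fun w => g (X w)).
  by move=> _ Y mY; rewrite setTI; exact: (measurable_RV_nat X (g @^-1` Y)).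
rewrite -U ge0_integral_bigcup //.
- rewrite (@eq_eseriesr _ _ (fun i => (g i * pr P [set w | X w = i])%:E)); last first.
    move=> i _; rewrite EFinM prE // -integral_cst //.
    by apply: eq_integral => w; rewrite inE /= => ->.
  apply/cvg_lim => //.
  have -> : (fun K => (\sum_(0 <= i < K) (g i * pr P [set w | X w = i])%:E)%E) =
      (fun K => (\sum_(i < K) g i * pr P [set w | X w = i])%:E).
    by apply/funext => K; rewrite big_mkord sumEFin.
  by apply: cvg_EFin; [exact: nearW | exact: cvl].
- by rewrite U; exact/measurable_EFinP.
- by move=> w _; rewrite lee_fin.
- by apply/trivIsetP => i j _ _ /eqP ij; apply/seteqP; split => // w [/= -> /ij].
Qed.

Lemma pr_neq0 (X : {RV P >-> nat}) :
  pr P [set w | X w <> 0%N] = 1 - pr P [set w | X w = 0%N].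
Proof.
have m0 : measurable [set w | X w = 0%N] by exact: (measurable_RV_nat X [set 0%N]).
have mn : measurable [set w | X w <> 0%N] by exact: (measurable_RV_nat X [set i | i <> 0%N]).
have D : [set w | X w = 0%N] `&` [set w | X w <> 0%N] = set0.
  by apply/seteqP; split => // w [].
have U : [set w | X w = 0%N] `|` [set w | X w <> 0%N] = setT.
  by apply/seteqP; split => // w _; case: (pselect (X w = 0%N)); [left | right].
by have := prU P m0 mn D; rewrite U prT => ->; rewrite addrAC subrr add0r.
Qed.

End NatRV.

(** * Asymptotics of the survival probability *)

Section Survival.
Context {R : realType} {d : measure_display} {T : measurableType d}.
Context {P : probability T R} (Z : R -> {RV P >-> nat}).
Variables (n : nat) (b : int -> R -> R) (Cb c T0 : R).
Hypothesis b_ge0 : forall k t, k \in jumps n -> 0 <= t -> 0 <= b k t.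
Hypothesis b_bmf : forall a k, k \in jumps n -> bmf a (b k).
Hypothesis b_le : forall t, 0 <= t -> total_rate n b t <= Cb.
Hypothesis n_gt0 : (0 < n)%N.
Hypothesis c_gt0 : 0 < c.
Hypothesis T0_ge0 : 0 <= T0.
Hypothesis birth_ge : forall t, T0 <= t -> c <= birth_rate n b t.
Hypothesis bdZ : birth_death_process n b Z.

Local Notation nu := (nu n b).
Local Notation Gam := (Gam n b).

Definition surv (a : R) : R := 1 - pr P [set w | Z a w = 0%N].

Lemma surv_ge0 a : 0 <= surv a.
Proof.
by rewrite subr_ge0 pr_le1 //; exact: (measurable_RV_nat _ [set 0%N]).
Qed.

Lemma surv_gt0 a : 0 <= a -> 0 < surv a.
Proof.
move=> a0; rewrite lt_neqAle surv_ge0 andbT eq_sym; apply/eqP => s0.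
by have := survival_lower b_ge0 b_bmf bdZ a0; rewrite -/(surv a) s0 mul0r ler10.
Qed.

Lemma surv_upper a : 0 <= a ->
  surv a * (Gam a + (1 + nu a) / 2 - n%:R ^+ 3 * Cb * itg (fun u => nu u * q1 n b a u) 0 a) <= 1.
Proof.
move=> a0; set X := Gam a + _ - _.
pose p i := pr P [set w | Z a w = i].
(* With [K.+1] the range always contains state 0, so the survival sum is the truncated total mass
   minus [p 0]. *)
have E K : \sum_(i < K.+1) (val i != 0%N)%:R * p i = \sum_(i < K.+1) p i - p 0%N.
  rewrite !big_ord_recl /= mul0r add0r [RHS]addrAC subrr add0r; apply: eq_bigr => i _.
  by rewrite mul1r.
have cv : (fun K => (\sum_(i < K.+1) p i - p 0%N) * X) @ \oo --> surv a * X.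
  apply: cvgMl; apply: cvgB; last exact: cvg_cst.
  by have := pr_sum_cvg1 (Z a); rewrite -cvg_shiftS.
apply: (cvgr_to_le cv); apply: nearW => K; rewrite -E.
exact: (survival_upper b_ge0 b_bmf b_le bdZ).
Qed.

Hypothesis Gam_pinfty : Gam a @[a --> +oo] --> +oo.
Hypothesis MGam_pinfty : (nu a)^-1 * Gam a @[a --> +oo] --> +oo.

Lemma survGam_cvg : surv a * Gam a @[a --> +oo] --> (1 : R).
Proof.
apply/cvgrPdist_le => e e0.
(* [del <= 1 / 2] first yields the crude bound [x <= 2] for [x = surv a * Gam a]; then the error
   [del * x] is at most [2 * del <= e]. *)
pose del := Num.min (1 / 2) (e / 2).
have del0 : 0 < del by rewrite lt_min !divr_gt0.
have del1 : del <= 1 / 2 by rewrite ge_min lexx.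
have del2 : del <= e / 2 by rewrite ge_min lexx orbT.
have Cb0 := Cb_ge0 b_ge0 b_le.
pose C := n%:R ^+ 3 * Cb.
have C0 : 0 <= C by rewrite mulr_ge0 // exprn_ge0.
have C1 : 0 < C + 1 by rewrite ltr_wpDl.
have [T1 T01 hT1] := nu_negligible T0 MGam_pinfty del0.
have near1 := itg_nu_q1_small b_ge0 b_bmf b_le n_gt0 c_gt0 T0_ge0 birth_ge
  Gam_pinfty MGam_pinfty (divr_gt0 del0 C1).
near=> a.
have a0 : 0 <= a by near: a; exact: near_ge.
have aT : T1 <= a by near: a; exact: near_ge.
have G1 : del^-1 <= Gam a by near: a; exact: (Gam_large Gam_pinfty).
have G0 : 0 <= Gam a by rewrite (le_trans _ G1) // invr_ge0 ltW.
have herr : C * itg (fun u => nu u * q1 n b a u) 0 a <= del * Gam a.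
  have h : itg (fun u => nu u * q1 n b a u) 0 a <= del / (C + 1) * Gam a by near: a.
  apply: le_trans (ler_wpM2l C0 h) _; rewrite mulrA ler_wpM2r // mulrA ler_pdivrMr //.
  by rewrite mulrC ler_wpM2l ?(ltW del0) // lerDl.
have hnu := hT1 a aT.
have h1 : 1 <= del * Gam a by rewrite mulrC -ler_pdivrMr // mul1r.
have nu0 := nu_gt0 n b a.
have lo := survival_lower b_ge0 b_bmf bdZ a0.
have up := surv_upper a0.
rewrite -/(surv a) in lo; rewrite -/C in up.
have s0 := surv_ge0 a.
set x := surv a * Gam a.
have x0 : 0 <= x by rewrite mulr_ge0.
have k1 : 1 <= x + del * x.
  apply: le_trans lo _; have -> : x + del * x = surv a * (Gam a + del * Gam a) by rewrite /x; ring.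
  by rewrite ler_wpM2l // lerD2l; lra.
have k2 : x - del * x <= 1.
  apply: le_trans up; have -> : x - del * x = surv a * (Gam a - del * Gam a) by rewrite /x; ring.
  by rewrite ler_wpM2l //; lra.
have k3 : del * x <= x / 2.
  by rewrite mulrC ler_wpM2l //; move: del1; rewrite mul1r.
have x2 : x <= 2 by lra.
have k4 : del * x <= del * 2 by rewrite ler_wpM2l // ltW.
by rewrite ler_norml; apply/andP; split; lra.
Unshelve. all: by end_near. Qed.

End Survival.

(** * The conditioned moments and their limit *)

Theorem theorem6 (R : realType) (n : nat) (b : int -> R -> R)
    (d : measure_display) (T : measurableType d) (P : probability T R)
    (Z : R -> {RV P >-> nat})
    (d' : measure_display) (T' : measurableType d') (Q : R -> probability T' R)
    (zeta : forall t : R, {RV (Q t) >-> nat}) :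
  (1 <= n)%N ->
  (forall k, k \in jumps n -> measurable_fun (`[0, +oo[ : set R) (b k)) ->
  (forall k t, k \in jumps n -> 0 <= t -> 0 <= b k t) ->
  birth_death_process n b Z ->
  (forall t, 0 <= t -> conditioned_on_nonzero (Z t) (zeta t)) ->
  (0 < limf_einf (fun t => (b (-1) t)%:E) +oo%R)%E ->
  (0 < limf_einf (fun t => (birth_rate n b t)%:E) +oo%R)%E ->
  (ereal_sup [set (total_rate n b t)%:E | t in `[0%R, +oo[] < +oo)%E ->
  Gamma n b Z t @[t --> +oo] --> +oo ->
  mean (Z t) * Gamma n b Z t @[t --> +oo] --> +oo ->
  forall r : nat, (1 <= r)%N ->
    'E_(Q t)[fun w => (((zeta t w)%:R / mean (zeta t)) ^+ r)%R]%E @[t --> +oo]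
      --> (r`!%:R)%:E.
Proof.
move=> n_gt0 mb b_ge0 bdZ hzeta _ hbirth hsup hG hMG r r_gt0.
have [Cb b_le] : exists Cb, forall t, 0 <= t -> total_rate n b t <= Cb.
  set S := (X in ereal_sup X) in hsup.
  have hS t : 0 <= t -> ((total_rate n b t)%:E <= ereal_sup S)%E.
    by move=> t0; apply: ereal_sup_ubound; exists t => //=; rewrite in_itv /= t0.
  exists (fine (ereal_sup S)) => t t0; rewrite -lee_fin fineK ?hS //.
  rewrite fin_numElt hsup andbT; apply: lt_le_trans (hS 0 (lexx _)).
  exact: ltNyr.
have [c c_gt0 [T0 T0_ge0 birth_ge]] : exists2 c : R, 0 < c & exists2 T0, 0 <= T0 &
    forall t, T0 <= t -> c <= birth_rate n b t.
  move: hbirth; rewrite limf_einfE => /ereal_sup_gt[_ [V [M [_ hM]] <-]] hV.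
  have hc t : M < t -> (ereal_inf [set (birth_rate n b t)%:E | t in V] <= (birth_rate n b t)%:E)%E.
    by move=> Mt; apply: ereal_inf_lbound; exists t => //; exact: hM.
  have M1 : M < M + 1 by rewrite ltrDl.
  have fi : ereal_inf [set (birth_rate n b t)%:E | t in V] \is a fin_num.
    rewrite fin_numElt (lt_trans _ hV) ?ltNyr //=.
    by apply: le_lt_trans (hc _ M1) _; exact: ltry.
  exists (fine (ereal_inf [set (birth_rate n b t)%:E | t in V])).
    by rewrite -lte_fin fineK.
  (* [V] is only known to contain the times strictly above [M]. *)
  exists (Num.max 0 (M + 1)); first by rewrite le_max lexx.
  move=> t; rewrite ge_max => /andP[_ Mt]; rewrite -lee_fin fineK // hc //.
  exact: lt_le_trans Mt.
have b_bmf a k : k \in jumps n -> bmf a (b k).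
  move=> kj; split.
    apply: measurable_funS (mb k kj) => //.
    by move=> x /=; rewrite !in_itv /= => /andP[->].
  exists Cb => x /andP[x0 _]; rewrite ger0_norm ?b_ge0 //.
  apply: le_trans (b_le x x0); rewrite total_rateE (big_rem k kj) lerDl big_seq.
  by apply: sumr_ge0 => j /mem_rem jj; exact: b_ge0.
have nu0 t : 0 < nu n b t by exact: nu_gt0.
(* The case [r = 1] of [moment_exact], where the sum of coefficients is 1. *)
have meanZ t : 0 <= t -> mean (Z t) = (nu n b t)^-1.
  move=> t0; rewrite /mean (@expectation_nat _ _ _ _ (Z t) (fun i => i%:R) (nu n b t)^-1) //.
  have := moment_exact b_bmf bdZ t0 (ltn0Sn 0).
  rewrite big_ord1 coef_0 mulr1 expr1.
  by under eq_fun do under eq_bigr do rewrite expr1.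
have GammaE t : 0 <= t -> Gamma n b Z t = Gam n b t.
  move=> t0; apply: eq_itg => u /andP[u0 _]; rewrite meanZ //.
  by field; rewrite gt_eqF.
have Gam_pinfty : Gam n b a @[a --> +oo] --> +oo.
  apply/cvgryPge => A; move/cvgryPge : hG => /(_ A) hA.
  by apply: filterS2 hA (near_ge 0) => t + t0; rewrite GammaE.
have MGam_pinfty : (nu n b a)^-1 * Gam n b a @[a --> +oo] --> +oo.
  apply/cvgryPge => A; move/cvgryPge : hMG => /(_ A) hA.
  by apply: filterS2 hA (near_ge 0) => t + t0; rewrite GammaE // meanZ.
pose e r t := \sum_(k < r) coef n b t r k 0.
have przeta t i : 0 <= t -> pr (Q t) [set w | zeta t w = i] =
    (i != 0%N)%:R * pr P [set w | Z t w = i] / surv Z t.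
  move=> t0; rewrite /surv -pr_neq0.
  have := hzeta t t0 [set i]; rewrite /distribution /pushforward /= /pr => ->.
  rewrite /cprob /=; congr (_ / _); rewrite -/(pr P _).
  case: eqP => [->|i0].
    rewrite mul0r (_ : _ `&` _ = set0) ?/pr ?measure0 //.
    by apply/seteqP; split => // w [].
  rewrite mul1r; congr pr; apply/seteqP; split => w /=; first by case.
  by move=> ->.
(* The free factor [x] serves both the mean ([x = 1]) and the normalized moments ([x] the inverse
   mean); [0 < j] makes the term of state 0 vanish on both sides. *)
have zeta_moment t j x : 0 <= t -> (0 < j)%N -> 0 <= x ->
    ('E_(Q t)[fun w => (((zeta t w)%:R * x) ^+ j)%R] =
      (x ^+ j * (nu n b t ^- j * e j t) / surv Z t)%:E)%E.
  move=> t0 j0 x0.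
  apply: (@expectation_nat _ _ _ _ (zeta t) (fun i => (i%:R * x) ^+ j)).
    by move=> i; rewrite exprn_ge0 // mulr_ge0.
  have -> : (fun K => \sum_(i < K) (i%:R * x) ^+ j * pr (Q t) [set w | zeta t w = i]) =
     (fun K => x ^+ j * (\sum_(i < K) i%:R ^+ j * pr P [set w | Z t w = i]) * (surv Z t)^-1).
    apply/funext => K; rewrite mulr_sumr mulr_suml; apply: eq_bigr => i _.
    rewrite przeta // exprMn; case: (val i) => [|i'] /=; last by rewrite mul1r; ring.
    by rewrite expr0n gtn_eqF //= !(mul0r, mulr0).
  by apply: cvgMl; apply: cvgMr; exact: (moment_exact b_bmf bdZ).
have mean_zeta t : 0 <= t -> mean (zeta t) = (nu n b t)^-1 / surv Z t.
  move=> t0; rewrite /mean.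
  have := zeta_moment t 1%N 1 t0 (ltn0Sn 0) ler01.
  rewrite /e big_ord1 coef_0 !expr1n mulr1 mul1r expr1.
  by under eq_fun do rewrite mulr1 expr1; move=> ->.
(* The powers of [nu] cancel; normalization contributes [surv ^+ r], and conditioning divides by
   [surv] once. *)
have moment t : 0 <= t ->
    ('E_(Q t)[fun w => (((zeta t w)%:R / mean (zeta t)) ^+ r)%R] =
      (e r t * surv Z t ^+ r.-1)%:E)%E.
  move=> t0; have s0 := surv_gt0 b_ge0 b_bmf bdZ t0.
  rewrite zeta_moment //; last by rewrite mean_zeta // invr_ge0 divr_ge0 ?invr_ge0 // ltW.
  congr EFin; rewrite mean_zeta // invfM !invrK.
  have s1 := lt0r_neq0 s0; have n1 := lt0r_neq0 (nu0 t).
  move: (e r t) => x; case: (r) r_gt0 => // r' _ /=.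
  by rewrite exprMn (exprS (surv Z t) r'); field; rewrite s1 expf_neq0.
have e_cvg : e r t / Gam n b t ^+ r.-1 @[t --> +oo] --> (r`!%:R : R).
  apply/cvgrPdist_le => eps eps0.
  have h1 := sum_coef_asymptotics b_ge0 b_bmf b_le n_gt0 c_gt0 T0_ge0 birth_ge
    Gam_pinfty MGam_pinfty r_gt0 eps0.
  apply: filterS2 h1 (Gam_large Gam_pinfty 1) => t h G1.
  have G0 : 0 < Gam n b t ^+ r.-1 by rewrite exprn_gt0 // (lt_le_trans _ G1).
  have -> : r`!%:R - e r t / Gam n b t ^+ r.-1 =
      - (e r t - r`!%:R * Gam n b t ^+ r.-1) / Gam n b t ^+ r.-1.
    by field; rewrite gt_eqF.
  by rewrite normrM normrN normfV (gtr0_norm G0) ler_pdivrMr.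
(* [e] grows like [Gam ^+ r.-1] and [surv] behaves like [1 / Gam]; inserting [Gam ^+ r.-1],
   eventually nonzero, separates two convergent factors. *)
have F_cvg : e r t * surv Z t ^+ r.-1 @[t --> +oo] --> (r`!%:R : R).
  have sG := survGam_cvg b_ge0 b_bmf b_le n_gt0 c_gt0 T0_ge0 birth_ge bdZ Gam_pinfty MGam_pinfty.
  have sGr : (surv Z t * Gam n b t) ^+ r.-1 @[t --> +oo] --> (1 : R).
    rewrite -[X in _ --> X](expr1n _ r.-1).
    apply: (@cvg_comp _ _ _ (fun t => surv Z t * Gam n b t) (fun x => x ^+ r.-1)); first exact: sG.
    exact: exprn_continuous.
  have h := cvgM e_cvg sGr; rewrite mulr1 in h.
  have E : \forall t \near +oo, e r t / Gam n b t ^+ r.-1 * (surv Z t * Gam n b t) ^+ r.-1 =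
      e r t * surv Z t ^+ r.-1.
    apply: filterS (Gam_large Gam_pinfty 1) => t G1.
    have G0 : Gam n b t ^+ r.-1 != 0 by rewrite expf_neq0 // gt_eqF // (lt_le_trans _ G1).
    by rewrite exprMn; field.
  apply: (cvg_trans (@near_eq_cvg _ _ _ _
    (fun t => e r t / Gam n b t ^+ r.-1 * (surv Z t * Gam n b t) ^+ r.-1)
    (fun t => e r t * surv Z t ^+ r.-1) E)).
  exact: h.
have hE : \forall t \near +oo, (e r t * surv Z t ^+ r.-1)%:E =
    'E_(Q t)[fun w => (((zeta t w)%:R / mean (zeta t)) ^+ r)%R]%E.
  by apply: filterS (near_ge 0) => t t0; rewrite moment.
apply: (cvg_trans (@near_eq_cvg _ _ _ _ (fun t => (e r t * surv Z t ^+ r.-1)%:E)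
  (fun t => 'E_(Q t)[fun w => (((zeta t w)%:R / mean (zeta t)) ^+ r)%R]%E) hE)).
by apply: cvg_EFin; [exact: nearW | exact: F_cvg].
Qed.
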